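(* Let $K\in\mathcal{K}_e^2$ be an origin-symmetric convex body in $\mathbb{R}^2$, let $q>2$ be a real number, and let $L\subset\mathbb{R}^2$ be a line through the origin. Then $$\frac{\widetilde{\mathrm{C}}_q(K,\mathbb{S}^1\cap L)}{\widetilde{\mathrm{C}}_q(K,\mathbb{S}^1)}<\frac{q-1}{q}.$$
   Context: A convex body in $\mathbb{R}^n$ is a non-empty convex compact subset of $\mathbb{R}^n$. $\mathcal{K}_o^n$ is the set of convex bodies in $\mathbb{R}^n$ having the origin as an interior point, and $\mathcal{K}_e^n$ is the set of those $K\in\mathcal{K}_o^n$ with $K=-K$. $\langle\cdot,\cdot\rangle$ is the standard inner product, $|\cdot|$ the Euclidean norm, $\mathbb{S}^{n-1}$ the Euclidean unit sphere in $\mathbb{R}^n$, and $\mathcal{H}^{n-1}$ the $(n-1)$-dimensional Hausdorff measure. For $K\in\mathcal{K}_o^n$: the support function is $h_K(x)=\max_{y\in K}\langle x,y\rangle$; the radial function is $\rho_K(x)=\max\{\rho>0:\rho x\in K\}$ for $x\in\mathbb{R}^n\setminus\{0\}$; for $v\in\mathbb{S}^{n-1}$ the supporting hyperplane is $H_K(v)=\{x\in\mathbb{R}^n:\langle x,v\rangle=h_K(v)\}$. For $\eta\subseteq\mathbb{S}^{n-1}$ the reverse radial Gauss image is $$\alpha_K^*(\eta)=\{u\in\mathbb{S}^{n-1}:\rho_K(u)u\in H_K(v)\text{ for some }v\in\eta\}.$$ For $q\in\mathbb{R}$ the $q$th dual curvature measure of $K$ is defined for Borel sets $\eta\subseteq\mathbb{S}^{n-1}$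 by $$\widetilde{\mathrm{C}}_q(K,\eta)=\frac1n\int_{\alpha_K^*(\eta)}\rho_K(u)^q\,d\mathcal{H}^{n-1}(u).$$ Here these are used with $n=2$. *)

(* Defs.v *)
From HB Require Import structures.
From mathcomp Require Import all_boot all_order all_algebra.
From mathcomp Require Import all_classical all_reals all_analysis.

Set Implicit Arguments.
Unset Strict Implicit.
Unset Printing Implicit Defensive.
Import Order.TTheory GRing.Theory Num.Theory.
Import numFieldNormedType.Exports.

Local Open Scope classical_set_scope.
Local Open Scope ring_scope.

Section euclidean.
Context {R : realType} {n : nat}.
Implicit Types (x y : 'rV[R]_n) (K L : set 'rV[R]_n).

Definition dotp x y : R := \sum_(i < n) x 0 i * y 0 i.

(* The library norm [`|x|] on ['rV[R]_n] is the sup norm. *)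
Definition enorm x : R := Num.sqrt (dotp x x).

Definition usphere : set 'rV[R]_n := [set u | enorm u = 1].

Definition line_through_origin L :=
  exists2 v : 'rV[R]_n, v != 0 & L = range (fun t : R => t *: v).

Definition convex_body K := [/\ K !=set0, convex_set K & compact K].

Definition convex_body_o K := convex_body K /\ interior K 0.

Definition convex_body_e K := convex_body_o K /\ K = [set - x | x in K].

End euclidean.

Section dual_curvature_data.
Context {R : realType} {n : nat}.
Implicit Types (x u v : 'rV[R]_n) (K eta : set 'rV[R]_n).

(* For K in K_o^n both suprema below are attained. *)
Definition support_fun K x : R := sup [set dotp x y | y in K].

Definition radial_fun K x : R := sup [set r : R | 0 < r /\ K (r *: x)].

Definition supporting_hyperplane K v : set 'rV[R]_n :=
  [set x | dotp x v = support_fun K v].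

Definition reverse_radial_Gauss_image K eta : set 'rV[R]_n :=
  [set u | usphere u /\
     exists2 v, eta v & supporting_hyperplane K v (radial_fun K u *: u)].

End dual_curvature_data.

Section hausdorff.
Local Open Scope ereal_scope.
Context {R : realType} {n : nat}.
Implicit Types (A B : set 'rV[R]_n) (F : (set 'rV[R]_n)^nat).

(* 0 is thrown in so that the diameter of the empty set is 0, not -oo. *)
Definition ediam A : \bar R :=
  ereal_sup (0 |` [set (enorm (p.1 - p.2)%R)%:E | p in A `*` A]).

Definition delta_cover (delta : R) A : set ((set 'rV[R]_n)^nat) :=
  [set F | A `<=` \bigcup_k F k /\ forall k, ediam (F k) <= delta%:E].

Definition hausdorff1_delta (delta : R) A : \bar R :=
  ereal_inf [set \sum_(k <oo) ediam (F k) | F in delta_cover delta A].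

(* The 1-dimensional Hausdorff (outer) measure; the normalizing factor
   omega_d / 2^d of the d-dimensional one is 1 for d = 1. *)
Definition hausdorff1 A : \bar R :=
  ereal_sup [set hausdorff1_delta delta A | delta in [set d : R | (0 < d)%R]].

Lemma ediam_ge0 A : 0 <= ediam A.
Proof. by apply: ereal_sup_ubound; left. Qed.

Lemma ediam0 : ediam set0 = 0.
Proof.
rewrite /ediam (_ : _ @` _ = set0) ?setU0 ?ereal_sup1//.
by apply/seteqP; split => // _ [[x y] [[]]].
Qed.

Lemma hausdorff1_delta_ge0 delta A : 0 <= hausdorff1_delta delta A.
Proof.
apply: le_ereal_inf_tmp => _ [F _ <-].
by apply: nneseries_ge0 => k _ _; exact: ediam_ge0.
Qed.

Lemma hausdorff1_ge0 A : 0 <= hausdorff1 A.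
Proof.
apply: le_trans (hausdorff1_delta_ge0 1 A) _.
by apply: ereal_sup_ubound; exists 1%R => //=.
Qed.

Lemma hausdorff1_delta0 (delta : R) :
  (0 < delta)%R -> hausdorff1_delta delta set0 = 0.
Proof.
move=> d0; apply/eqP; rewrite eq_le hausdorff1_delta_ge0 andbT.
apply: ereal_inf_lbound; exists (fun=> set0).
  by split => // k; rewrite ediam0 lee_fin ltW.
by rewrite eseries0// => k _ _; rewrite ediam0.
Qed.

Lemma hausdorff1_set0 : hausdorff1 set0 = 0.
Proof.
apply/eqP; rewrite eq_le hausdorff1_ge0 andbT.
by apply: ge_ereal_sup => _ [d d0 <-]; rewrite hausdorff1_delta0.
Qed.

Lemma le_hausdorff1_delta delta :
  {homo hausdorff1_delta delta : A B / A `<=` B >-> A <= B}.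
Proof.
move=> A B AB; apply: ereal_inf_le_tmp => _ [F [BF dF] <-].
by exists F => //; split => //; exact: subset_trans BF.
Qed.

Lemma le_hausdorff1 : {homo hausdorff1 : A B / A `<=` B >-> A <= B}.
Proof.
move=> A B AB; apply: ge_ereal_sup => _ [d d0 <-].
apply: le_trans (le_hausdorff1_delta d AB) _.
by apply: ereal_sup_ubound; exists d.
Qed.

Lemma hausdorff1_delta_sigma_subadditive delta :
  sigma_subadditive (hausdorff1_delta delta).
Proof.
move=> A.
have [[i ioo]|] := pselect (exists i, hausdorff1_delta delta (A i) = +oo).
  rewrite (eseries_pinfty _ _ ioo) ?leey// => k _.
  by rewrite -ltNye (lt_le_trans _ (hausdorff1_delta_ge0 _ _)).
rewrite -forallNE => Aoo.
apply/lee_addgt0Pr => _/posnumP[e].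
rewrite (le_trans _ (epsilon_trick _ _ _))//; last first.
  by move=> k; exact: hausdorff1_delta_ge0.
pose P k F := delta_cover delta (A k) F /\
  \sum_(j <oo) ediam (F j) <=
    hausdorff1_delta delta (A k) + (e%:num / (2 ^ k.+1)%:R)%:E.
have [G PG] : {G : ((set 'rV[R]_n)^nat)^nat & forall k, P k (G k)}.
  apply: (@choice _ _ P) => k.
  have ek : (0 < e%:num / (2 ^ k.+1)%:R :> R)%R by [].
  have Afin : hausdorff1_delta delta (A k) \is a fin_num.
    by rewrite ge0_fin_numE ?hausdorff1_delta_ge0// ltey; exact/eqP/Aoo.
  have [_ [F cF <-] Fe] := lb_ereal_inf_adherent ek Afin.
  by exists F; split => //; exact: ltW.
pose D (p : nat * nat) := ediam (G p.1 p.2).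
have D0 p : 0 <= D p by exact: ediam_ge0.
apply: (@le_trans _ _ (\esum_(p in setT) D p)).
  have /card_esym/ppcard_eqP[f] := card_nat2.
  apply: ereal_inf_lbound; exists (uncurry G \o f).
    split => [t [i _ Ait]|k]; last first.
      rewrite /= /uncurry; case: (f k) => i j.
      exact: (PG i).1.2.
    have [j _ Gijt] := (PG i).1.1 _ Ait.
    by exists (f^-1%FUN (i, j)) => //=; rewrite invK ?inE.
  rewrite (_ : (fun k => _) = (fun N => \sum_(0 <= k < N) (D \o f) k)); last first.
    apply/funext => N; apply: eq_bigr => k _ /=; congr ediam.
    by rewrite /uncurry; case: (f k).
  rewrite -(esum_pred_image D _ xpredT) ?[fun=> _]set_true//.
  by rewrite image_eq.
rewrite (_ : esum _ _ = \sum_(i <oo) \sum_(j <oo) D (i, j)); last first.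
  pose J : nat -> set (nat * nat) := fun i => [set (i, j) | j in setT].
  rewrite (_ : setT = \bigcup_k J k); last first.
    by rewrite predeqE => -[a b]; split => // _; exists a => //; exists b.
  rewrite esum_bigcupT //=; last first.
    apply/trivIsetP => i j _ _ ij.
    rewrite predeqE => -[a b] /=; split => //= -[] [_] _ [<-{a} _].
    by move=> [m' _] [] /esym/eqP; rewrite (negbTE ij).
  rewrite -(image_id [set: nat]) -fun_true esum_pred_image//; last first.
    by move=> k _; exact: esum_ge0.
  apply: eq_eseriesr => /= j _.
  rewrite -(esum_pred_image D (pair j) predT)//=; last first.
    by move=> ? ? _ _; exact: (@can_inj _ _ _ snd).
  by congr esum; rewrite predeqE => -[a b]; split; move=> [i _ <-]; exists i.
apply: lee_nneseries => [i _ _|i _]; first exact: nneseries_ge0.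
exact: (PG i).2.
Qed.

Lemma hausdorff1_sigma_subadditive : sigma_subadditive hausdorff1.
Proof.
move=> A; apply: ge_ereal_sup => _ [d d0 <-].
apply: le_trans (hausdorff1_delta_sigma_subadditive d A) _.
apply: lee_nneseries => [k _ _|k _]; first exact: hausdorff1_delta_ge0.
by apply: ereal_sup_ubound; exists d.
Qed.

HB.instance Definition _ := isOuterMeasure.Build R 'rV[R]_n hausdorff1
  hausdorff1_set0 hausdorff1_ge0 le_hausdorff1 hausdorff1_sigma_subadditive.

(* The restriction of [hausdorff1] to its Caratheodory-measurable sets. *)
Definition hausdorff1_measure :
    set (caratheodory_type hausdorff1) -> \bar R := hausdorff1.

HB.instance Definition _ := isMeasure.Build _ _ _ hausdorff1_measure
  (@caratheodory_measure0 _ _ hausdorff1)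
  (@caratheodory_measure_ge0 _ _ hausdorff1)
  (@caratheodory_measure_sigma_additive _ _ hausdorff1).

End hausdorff.

Arguments hausdorff1_measure : clear implicits.

(* The q-th dual curvature measure in dimension n = 2, whence the factor 1/2. *)
Definition dual_curvature {R : realType} (q : R) (K eta : set 'rV[R]_2) :
    \bar R :=
  ((2^-1)%:E * \int[hausdorff1_measure R 2]_(u in
    reverse_radial_Gauss_image K eta) (radial_fun K u `^ q)%:E)%E.

(* Main.v *)
(* Let [w] span [L].  The reverse radial Gauss image of [w] is the arc over the face
   [m - e, m + e] of [K] with normal [w].  [K] contains the parallelogram spanned by
   this face and its opposite, with equality of the radial functions over the two
   faces, so it suffices to compare the integrals over the four sides of the
   parallelogram.  On the arc over a side [s |-> m + s e], |s| <= 1, the measure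
   [rho^q dH^1] pulls back to [|det (m, e)| |m + s e|^(q - 2) ds], and the claim
   becomes

     \int_(-1)^1 |m + s e|^p ds < (p + 1) \int_(-1)^1 |s m + e|^p ds,   p = q - 2 > 0.

   With [X = |m|^2], [Y = |e|^2], [B = <m, e>], integration by parts bounds the
   right-hand side from below, strictly, by
   [(1 + B / X) |m + e|^p + (1 - B / X) |m - e|^p], which bounds the left-hand side
   from above: by integration by parts again when [X <= Y], by convexity of
   [t |-> t^(p / 2)] when [p >= 2], and by the linear bounds
   [1 + k ln t <= t^k <= 1 + k (t - 1)], [k = p / 2], otherwise. *)
Require Import Defs.
From mathcomp Require Import all_boot all_order all_algebra.
From mathcomp Require Import all_classical all_reals all_analysis.
From mathcomp Require Import measurable_realfun ring lra.
Import Order.TTheory GRing.Theory Num.Theory.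
Import numFieldNormedType.Exports.
Local Open Scope classical_set_scope.
Local Open Scope ring_scope.

Set Implicit Arguments.
Unset Strict Implicit.
Unset Printing Implicit Defensive.

(** * An inequality between powers of quadratic forms *)

(** The factor [p + 1 = q - 1] comes out of integration by parts: with [k = p / 2] and
    [g = D + X (s + B / X)^2], the derivative of [(s + B / X) g^k] is
    [(2 k + 1) g^k - 2 k D g^(k - 1)]. The boundary terms sit at the corners of the parallelogram,
    which adjacent sides share, so a single expression can separate the two integrals. If the part
    over the faces is less than [q - 1] times the rest, its share of the sum is less than
    [(q - 1) / q].

    Two obstacles shape the rest. The measurability of the radial function and of the reverse radial
    Gauss image is never established; they are only compared, by monotonicity, with explicit
    measurable sets and functions. And Hausdorff measure is defined through covers, so the integral
    over an arc is compared directly with increments [W b - W a], where [W'] bounds the density on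
    one side; hence the majorants and minorants with explicit primitives.

    If [m] and [e] are dependent, the face is a point and its arc is null; a small square inside [K]
    then keeps the denominator positive. *)

Section quadratic_forms.
Context {R : realType}.
Implicit Types (a b c k r s t x y X Y B : R).

Lemma mulr_sub_powR_ge0 c x y k : 0 <= k -> 0 <= x -> 0 <= y ->
  0 <= c * (x - y) -> 0 <= c * (x `^ k - y `^ k).
Proof.
move=> k0 x0 y0 cxy; have [yx|xy] := leP y x.
  have [->|xney] := eqVneq x y; first by rewrite subrr mulr0.
  apply: mulr_ge0.
    by move: cxy; rewrite pmulr_lge0// subr_gt0 lt_neqAle yx eq_sym xney.
  by rewrite subr_ge0; apply: ge0_ler_powR => //; rewrite nnegrE.
apply: mulr_le0.
  by move: cxy; rewrite nmulr_lge0// subr_lt0.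
by rewrite subr_le0; apply: ge0_ler_powR => //; rewrite ?nnegrE// ltW.
Qed.

(** Young's inequality for [x^k] and [1] with exponents [1 / k] and [1 / (1 - k)]; the second one
    degenerates at [k = 1], hence the case split. *)
Lemma powR_le_tangent1 x k : 0 <= x -> 0 < k <= 1 ->
  x `^ k <= 1 + k * (x - 1).
Proof.
move=> x0 /andP[k0]; rewrite le_eqVlt => /predU1P[->|k1].
  by rewrite powRr1// mul1r addrC subrK.
have k10 : 0 < (1 - k)^-1 by rewrite invr_gt0 subr_gt0.
have := @conjugate_powR R (x `^ k) 1 k^-1 (1 - k)^-1 (powR_ge0 _ _) ler01.
rewrite invr_gt0 k0 k10 !invrK => /(_ isT isT).
rewrite addrC subrK => /(_ erefl).
rewrite mulr1 powR1 -powRrM mulfV ?gt_eqF// powRr1// mul1r.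
by lra.
Qed.

Lemma ln_ge1BV x : 0 < x -> 1 - x^-1 <= ln x.
Proof.
move=> x0; have := @le_ln1Dx R (x^-1 - 1).
rewrite subrKC lnV ?posrE// ltrBrDr addNr invr_gt0 => /(_ x0); lra.
Qed.

Lemma powR_ge1Dln x k : 0 < x -> 1 + k * ln x <= x `^ k.
Proof. by move=> x0; rewrite /powR gt_eqF//; exact: expR_ge1Dx. Qed.

(* [ln x >= 2 (1 - 1 / sqrt x)], so the left-hand side is at least
   [4 - 2 (sqrt (1 + a) + sqrt (1 - a))]. *)
Lemma entropy_ge a : -1 < a < 1 ->
  a ^+ 2 / 2 <= (1 + a) * ln (1 + a) + (1 - a) * ln (1 - a).
Proof.
move=> /andP[a1 a2].
have lnsqrt y : 0 < y -> 2 * (y - Num.sqrt y) <= y * ln y.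
  move=> y0; have sy0 : 0 < Num.sqrt y by rewrite sqrtr_gt0.
  have ey := sqr_sqrtr (ltW y0); have := ln_ge1BV sy0.
  have -> : ln y = 2 * ln (Num.sqrt y).
    by rewrite -{1}ey lnXn// mulr_natl.
  rewrite -(ler_pM2l y0).
  have -> : y * (1 - (Num.sqrt y)^-1) = y - Num.sqrt y.
    move: ey sy0; set z := Num.sqrt y => <- z0; field.
    by rewrite gt_eqF.
  by lra.
have a21 : a ^+ 2 < 1 by nra.
set u := Num.sqrt (1 + a); set v := Num.sqrt (1 - a).
have u0 : 0 <= u by rewrite sqrtr_ge0.
have v0 : 0 <= v by rewrite sqrtr_ge0.
have u2 : u ^+ 2 = 1 + a by rewrite sqr_sqrtr//; lra.
have v2 : v ^+ 2 = 1 - a by rewrite sqr_sqrtr//; lra.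
have uv : u * v <= 1 - a ^+ 2 / 2.
  have uv2 : (u * v) ^+ 2 = 1 - a ^+ 2 by rewrite exprMn u2 v2; ring.
  rewrite -(@ler_pXn2r _ 2)// ?nnegrE ?mulr_ge0//; last by lra.
  by rewrite uv2; have := sqr_ge0 (a ^+ 2); nra.
(* [(u + v)^2 = 2 + 2 u v <= 4 - a^2 <= (2 - a^2 / 4)^2]. *)
have uvs : u + v <= 2 - a ^+ 2 / 4.
  rewrite -(@ler_pXn2r _ 2)// ?nnegrE ?(addr_ge0 u0 v0)//; last by lra.
  rewrite sqrrD u2 v2; have := sqr_ge0 (a ^+ 2); nra.
have /lnsqrt : 0 < 1 + a by lra.
have /lnsqrt : 0 < 1 - a by lra.
by rewrite -/u -/v; lra.
Qed.

(** For [c = a] and [c = - a], [1 + r + 2 c = (1 + c)^2 + (r - a^2)]. Splitting off the squares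
    leaves twice the sum in [entropy_ge], at least [a^2], and a rational part, at least
    [2 (r - a^2) / 3] because [r <= 1]. The constant [2 r / 3] is the integral of [r s^2] over
    [[-1, 1]]. *)
Lemma log_mean_ge a r : a ^+ 2 < r -> r <= 1 ->
  2 * r / 3 <= (1 + a) * ln (1 + r + 2 * a) + (1 - a) * ln (1 + r - 2 * a).
Proof.
move=> ar r1.
have a1 : -1 < a < 1 by apply/andP; split; nra.
have [aN1 a2] := andP a1.
have step c : c ^+ 2 = a ^+ 2 -> -1 < c ->
    2 * ln (1 + c) + (r - a ^+ 2) / (1 + r + 2 * c) <= ln (1 + r + 2 * c).
  move=> ca c1; have c0 : 0 < 1 + c by lra.
  have t0 : 0 < 1 + r + 2 * c by nra.
  have := ln_ge1BV (divr_gt0 t0 (exprn_gt0 2 c0)).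
  rewrite ln_div ?posrE ?exprn_gt0// lnXn// invf_div.
  have -> : (1 + c) ^+ 2 / (1 + r + 2 * c) =
      1 - (r - a ^+ 2) / (1 + r + 2 * c).
    by rewrite -ca; field; rewrite gt_eqF.
  by lra.
have tp : 0 < 1 + r + 2 * a by nra.
have tm : 0 < 1 + r - 2 * a by nra.
have := step a erefl aN1; have := step (- a) (sqrrN _).
rewrite mulrN ltrN2 => /(_ a2) sm sp.
have E := entropy_ge a1.
apply: (@le_trans _ _ ((1 + a) * (2 * ln (1 + a) + (r - a ^+ 2) / (1 + r + 2 * a)) +
   (1 - a) * (2 * ln (1 - a) + (r - a ^+ 2) / (1 + r - 2 * a)))); last first.
  by apply: lerD; apply: ler_wpM2l => //; lra.
have H : 2 / 3 * (r - a ^+ 2) <=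
   (1 + a) * ((r - a ^+ 2) / (1 + r + 2 * a)) + (1 - a) * ((r - a ^+ 2) / (1 + r - 2 * a)).
  rewrite [leRHS](_ : _ = (2 * (1 + r) - 4 * a ^+ 2) / ((1 + r + 2 * a) * (1 + r - 2 * a)) * (r - a ^+ 2)); last first.
    by field; rewrite !gt_eqF.
  apply: ler_wpM2r; first lra.
  rewrite ler_pdivlMr ?mulr_gt0//; nra.
have := sqr_ge0 a; lra.
Qed.

Lemma is_derive_powR_comp (g : R -> R) k s (dg : R) : 0 < g s ->
  is_derive s 1 g dg ->
  is_derive s 1 (fun t => g t `^ k) (k * g s `^ (k - 1) * dg).
Proof.
move=> g0 gd; have := is_derive1_powR k g0 => H.
by have := is_derive1_comp (f := fun x => x `^ k) (g := g) H gd.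
Qed.

Lemma quadratic_gt0 X Y B s : 0 < X -> B ^+ 2 < X * Y ->
  0 < X + 2 * B * s + Y * s ^+ 2.
Proof.
move=> X0 BXY.
have H : X * (X + 2 * B * s + Y * s ^+ 2) =
  (X + B * s) ^+ 2 + (X * Y - B ^+ 2) * s ^+ 2 by ring.
rewrite -(pmulr_rgt0 _ X0) H.
have [->|s0] := eqVneq s 0; first by rewrite !mulr0 expr0n/= mulr0 !addr0 exprn_gt0.
by rewrite ltr_wpDl ?sqr_ge0// mulr_gt0 ?subr_gt0// exprn_even_gt0.
Qed.

(* Integrating [g^k] by parts against [s + B / X] leaves a positive remainder,
   which is bounded below by the linear term [c * s] of [V]. *)
Lemma quadratic_powR_minorant X Y B k : 0 < X -> B ^+ 2 < X * Y -> 0 < k ->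
  let g s := X * s ^+ 2 + 2 * B * s + Y in
  exists V dV : R -> R, [/\ forall s, is_derive s 1 V (dV s),
    forall s, -1 <= s <= 1 -> dV s <= g s `^ k &
    (1 + B / X) * g 1 `^ k + (1 - B / X) * g (-1) `^ k <
      (2 * k + 1) * (V 1 - V (-1))].
Proof.
move=> X0 BXY k0 g.
have Y0 : 0 < Y by rewrite -(pmulr_rgt0 _ X0) (le_lt_trans (sqr_ge0 B)).
have gE s : g s = Y + 2 * B * s + X * s ^+ 2 by rewrite /g; ring.
have g0 s : 0 < g s.
  by rewrite gE; apply: quadratic_gt0 => //; rewrite mulrC.
pose D := (X * Y - B ^+ 2) / X.
have D0 : 0 < D by rewrite divr_gt0// subr_gt0.
have gD s : g s = D + X * (s + B / X) ^+ 2.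
  by rewrite /g /D; field; rewrite gt_eqF.
(* On [[-1, 1]], [D <= g <= M], so [D^k / M <= g^k / g = g^(k - 1)] whatever the sign of [k - 1].
   Thus [c] is a lower bound for the remainder. *)
pose M := X + 2 * `|B| + Y.
have k1 : 0 < 2 * k + 1 by lra.
pose c := 2 * k / (2 * k + 1) * (D * (D `^ k / M)).
have M0 : 0 < M by rewrite /M; have := normr_ge0 B; lra.
have c0 : 0 < c.
  apply: mulr_gt0; first by apply: divr_gt0 => //; apply: mulr_gt0.
  by apply: mulr_gt0 => //; apply: divr_gt0 => //; exact: powR_gt0.
pose dg s := 2 * (X * s + B).
pose V s := ((s + B / X) * g s `^ k) / (2 * k + 1) + c * s.
pose dV s := (g s `^ k + (s + B / X) * (k * g s `^ (k - 1) * dg s)) / (2 * k + 1) + c.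
exists V, dV; split=> [s|s /andP[s1 s2]|].
- have dgs : is_derive s 1 g (dg s).
    rewrite /g /dg; apply: is_derive_eq; rewrite /GRing.scale/=; ring.
  have := is_derive_powR_comp k (g0 s) dgs => H.
  rewrite /V /dV; apply: is_derive_eq; rewrite /GRing.scale/=; ring.
- have gk : g s * g s `^ (k - 1) = g s `^ k by rewrite mulr_powRB1 // ltW.
  have -> : dV s = g s `^ k - 2 * k / (2 * k + 1) * (D * g s `^ (k - 1)) + c.
    rewrite /dV.
    have -> : (s + B / X) * (k * g s `^ (k - 1) * dg s) =
       2 * k * (g s `^ k - D * g s `^ (k - 1)).
      rewrite -gk; set P := _ `^ (k - 1); rewrite (gD s) /dg; field.
      by rewrite gt_eqF.
    field.
    by rewrite gt_eqF.
  rewrite -addrA gerDl addrC subr_le0 /c ler_pM2l ?divr_gt0 ?mulr_gt0//.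
  rewrite ler_pM2l//.
  have -> : g s `^ (k - 1) = g s `^ k / g s.
    by rewrite -gk mulrAC mulfV ?mul1r// gt_eqF.
  apply: ler_pM; rewrite ?powR_ge0 ?invr_ge0 ?(ltW M0)//.
    apply: ge0_ler_powR; rewrite ?nnegrE ?(ltW k0) ?(ltW D0) ?(ltW (g0 _))//.
    by rewrite gD lerDl mulr_ge0 ?sqr_ge0// ltW.
  rewrite lef_pV2 ?posrE// /M /g.
  have : B * s <= `|B|.
    rewrite (le_trans (ler_norm _))// normrM ler_piMr// ler_norml s1 s2//.
  have : s ^+ 2 <= 1 by nra.
  by move/(ler_wpM2l (ltW X0)); rewrite mulr1; lra.
- rewrite /V.
  have -> : (2 * k + 1) * ((1 + B / X) * g 1 `^ k / (2 * k + 1) + c * 1 -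
     ((-1 + B / X) * g (-1) `^ k / (2 * k + 1) + c * -1)) =
    (1 + B / X) * g 1 `^ k + (1 - B / X) * g (-1) `^ k + 2 * c * (2 * k + 1).
    by field; rewrite !gt_eqF.
  by rewrite ltrDl mulr_gt0// mulr_gt0.
Qed.

Lemma quadratic_powR_majorant X Y B k : 0 < X -> B ^+ 2 < X * Y -> 0 < k ->
  let f s := X + 2 * B * s + Y * s ^+ 2 in
  exists W dW : R -> R, [/\ forall s, is_derive s 1 W (dW s),
    forall s, -1 <= s <= 1 -> f s `^ k <= dW s &
    W 1 - W (-1) <= (1 + B / X) * f 1 `^ k + (1 - B / X) * f (-1) `^ k].
Proof.
move=> X0 BXY k0 f.
have Y0 : 0 < Y by rewrite -(pmulr_rgt0 _ X0) (le_lt_trans (sqr_ge0 B)).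
have f0 s : 0 < f s by exact: quadratic_gt0.
have f1 : f 1 = X + 2 * B + Y by rewrite /f; ring.
have fN1 : f (-1) = X - 2 * B + Y by rewrite /f; ring.
have fk s : f s * f s `^ (k - 1) = f s `^ k by rewrite mulr_powRB1 // ltW.
(* [f 1 - f (-1) = 4 B], so the difference of the powers has the sign of [B]. This permits raising
   the factor of [B] from [1 / Y], or from [0], to [1 / X]. *)
have comp c : 0 <= c -> 0 <= (c * B) * (f 1 `^ k - f (-1) `^ k).
  move=> c0; apply: mulr_sub_powR_ge0; rewrite ?(ltW k0) ?(ltW (f0 _))//.
  rewrite f1 fN1 (_ : _ * _ = 4 * (c * B ^+ 2)); last by ring.
  by apply: mulr_ge0 => //; apply: mulr_ge0 => //; exact: sqr_ge0.
have [XY|YX] := leP X Y.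
  (* [W'] exceeds [f^k] by [2 k Y f^(k - 1) (s + B / Y)^2]. The boundary terms carry [B / Y], which
     [comp] trades for [B / X]. *)
  pose df s := 2 * (B + Y * s).
  pose W s := (s + B / Y) * f s `^ k.
  pose dW s := f s `^ k + (s + B / Y) * (k * f s `^ (k - 1) * df s).
  exists W, dW; split=> [s|s _|].
  - have dfs : is_derive s 1 f (df s).
      rewrite /f /df; apply: is_derive_eq; rewrite /GRing.scale/=; ring.
    have := is_derive_powR_comp k (f0 s) dfs => H.
    rewrite /W /dW; apply: is_derive_eq; rewrite /GRing.scale/=; ring.
  - have -> : dW s = f s `^ k + 2 * k * Y * f s `^ (k - 1) * (s + B / Y) ^+ 2.
      by rewrite /dW /df; field; rewrite gt_eqF.
    rewrite lerDl; apply: mulr_ge0; last exact: sqr_ge0.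
    by apply: mulr_ge0; [nra|exact: powR_ge0].
  - have : 0 <= X^-1 - Y^-1 by rewrite subr_ge0 lef_pV2.
    by move=> /comp; rewrite /W; lra.
have [k1|k1] := leP 1 k.
  (* [f] lies below its chord on [[-1, 1]] and [t^k] is convex, so [f^k] lies below the chord of its
     end values; [W] is a primitive of that chord, with increment [a + b]. *)
  pose a := f 1 `^ k; pose b := f (-1) `^ k.
  pose W s := (s / 2 + s ^+ 2 / 4) * a + (s / 2 - s ^+ 2 / 4) * b.
  pose dW s := (1 + s) / 2 * a + (1 - s) / 2 * b.
  exists W, dW; split=> [s|s /andP[s1 s2]|].
  - rewrite /W /dW; apply: is_derive_eq; rewrite /GRing.scale/=; by field.
  - have t1a : 0 <= (1 + s) / 2 by lra.
    have t1b : (1 + s) / 2 <= 1 by lra.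
    have H : ((1 + s) / 2 * f 1 + (1 - (1 + s) / 2) * f (-1)) `^ k <=
             (1 + s) / 2 * a + (1 - (1 + s) / 2) * b.
      by apply: (convex_powR k1 (Itv01 t1a t1b)); rewrite inE/= in_itv/= andbT ltW.
    rewrite /dW; have -> : (1 - s) / 2 = 1 - (1 + s) / 2 by lra.
    apply: le_trans H; apply: ge0_ler_powR; rewrite ?nnegrE ?(ltW k0)// ?(ltW (f0 _))//.
      by apply: addr_ge0; apply: mulr_ge0; rewrite ?(ltW (f0 _))//; lra.
    rewrite f1 fN1 /f.
    have : s ^+ 2 <= 1 by nra.
    by move/(ler_wpM2l (ltW Y0)); lra.
  - by have := @comp X^-1; rewrite invr_ge0 ltW// => /(_ isT); rewrite /W -/a -/b; lra.
(* Here [Y < X] and [k < 1]. Up to the factor [X^k], the tangent bound integrates to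
   [2 + 2 k r / 3], while the logarithmic bound at the end points gives [2] plus [k] times the
   right-hand side of [log_mean_ge]. *)
pose r := Y / X; pose al := B / X.
have r0 : 0 < r by rewrite divr_gt0.
have r1 : r <= 1 by rewrite ler_pdivrMr// mul1r ltW.
have alr : al ^+ 2 < r.
  rewrite /al /r expr_div_n ltr_pdivrMr ?exprn_gt0// expr2 mulrA divfK ?gt_eqF//.
  by rewrite -expr2 mulrC.
have fX s : f s = X * (1 + 2 * al * s + r * s ^+ 2).
  by rewrite /f /al /r; field; rewrite gt_eqF.
have h0 s : 0 < 1 + 2 * al * s + r * s ^+ 2.
  by have := f0 s; rewrite fX pmulr_rgt0.
have XK0 : 0 < X `^ k by exact: powR_gt0.
have fXk s : f s `^ k = X `^ k * (1 + 2 * al * s + r * s ^+ 2) `^ k.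
  by rewrite fX powRM// ltW.
pose W s := X `^ k * (s + k * (al * s ^+ 2 + r * s ^+ 3 / 3)).
pose dW s := X `^ k * (1 + k * (2 * al * s + r * s ^+ 2)).
exists W, dW; split=> [s|s _|].
- rewrite /W /dW; apply: is_derive_eq; rewrite /GRing.scale/=; by field.
- rewrite fXk /dW ler_pM2l//; apply: le_trans (powR_le_tangent1 _ _) _.
  + exact: ltW.
  + by rewrite k0 ltW.
  + by lra.
- rewrite /W !fXk -/al.
  have -> : X `^ k * (1 + k * (al * 1 ^+ 2 + r * 1 ^+ 3 / 3)) -
    X `^ k * (-1 + k * (al * (-1) ^+ 2 + r * (-1) ^+ 3 / 3)) =
    X `^ k * (2 + k * (2 * r / 3)) by field.
  rewrite [(1 + al) * _]mulrCA [(1 - al) * _]mulrCA -mulrDr ler_pM2l//.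
  have al1 : -1 < al < 1 by apply/andP; split; nra.
  have := ler_wpM2l (ltW k0) (log_mean_ge alr r1).
  have -> : 1 + 2 * al * 1 + r * 1 ^+ 2 = 1 + r + 2 * al by ring.
  have -> : 1 + 2 * al * -1 + r * (-1) ^+ 2 = 1 + r - 2 * al by ring.
  have tp : 0 < 1 + r + 2 * al by have := h0 1; lra.
  have tm : 0 < 1 + r - 2 * al by have := h0 (-1); lra.
  have wp : 0 <= 1 + al by lra.
  have wm : 0 <= 1 - al by lra.
  have := ler_wpM2l wp (powR_ge1Dln k tp).
  have := ler_wpM2l wm (powR_ge1Dln k tm).
  lra.
Qed.

End quadratic_forms.

(** * One-dimensional Hausdorff measure *)

Section hausdorff_theory.
Context {R : realType}.
Local Open Scope ereal_scope.

Lemma nneseries_le_ub (u : (\bar R)^nat) (M : \bar R) :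
  (forall k, 0 <= u k) -> (forall N, \sum_(0 <= k < N) u k <= M) ->
  \sum_(k <oo) u k <= M.
Proof.
move=> u0 uM; apply: lime_le; last by near=> N; exact: uM.
by apply: is_cvg_nneseries => k _ _; exact: u0.
Unshelve. all: by end_near. Qed.

Section arbitrary_dimension.
Context {n : nat}.
Implicit Types (A B : set 'rV[R]_n) (x y : 'rV[R]_n).

Lemma le_ediam A B : A `<=` B -> ediam A <= ediam B.
Proof.
move=> AB; apply: ereal_sup_le => z [->|[p [p1 p2] <-]]; first by left.
by right; exists p => //; split; exact: AB.
Qed.

Lemma ediam_le A (M : R) : (0 <= M)%R ->
  (forall x y, A x -> A y -> (enorm (x - y) <= M)%R) -> ediam A <= M%:E.
Proof.
move=> M0 AM; apply: ge_ereal_sup => z [->//|[[x y] [/= Ax Ay] <-]].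
by rewrite lee_fin AM.
Qed.

Lemma enorm_le_ediam A x y : A x -> A y -> (enorm (x - y))%:E <= ediam A.
Proof. by move=> Ax Ay; apply: ereal_sup_ubound; right; exists (x, y). Qed.

Lemma hausdorff1_delta_anti A (d e : R) : (d <= e)%R ->
  hausdorff1_delta e A <= hausdorff1_delta d A.
Proof.
move=> de; apply: ereal_inf_le_tmp => _ [F [AF dF] <-].
by exists F => //; split=> // k; apply: le_trans (dF k) _; rewrite lee_fin.
Qed.

(** A set of diameter at most [d < e] cannot meet both [A] and [B], so each member of a cover of the
    union is charged to only one of them. *)
Lemma hausdorff1_delta_separated A B (d e : R) : (d < e)%R ->
  (forall x y, A x -> B y -> (e <= enorm (x - y))%R) ->
  hausdorff1_delta d A + hausdorff1_delta d B <= hausdorff1_delta d (A `|` B).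
Proof.
move=> de sepAB; apply: le_ereal_inf_tmp => _ [F [ABF dF] <-].
apply: (@le_trans _ _ (\sum_(k <oo) (ediam (F k `&` A) + ediam (F k `&` B)))).
  rewrite nneseriesD; try by move=> *; exact: ediam_ge0.
  apply: leeD; apply: ereal_inf_lbound.
    exists (fun k => F k `&` A) => //; split=> [x Ax|k].
      by have [k _ Fkx] := ABF x (or_introl Ax); exists k.
    by apply: le_trans (dF k); apply: le_ediam; exact: subIsetl.
  exists (fun k => F k `&` B) => //; split=> [x Bx|k].
    by have [k _ Fkx] := ABF x (or_intror Bx); exists k.
  by apply: le_trans (dF k); apply: le_ediam; exact: subIsetl.
apply: lee_nneseries => [k _ _|k _]; first by apply: adde_ge0; exact: ediam_ge0.
have [[x [Fx Ax]]|FA0] := pselect (F k `&` A !=set0); last first.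
  move/set0P/negP/negPn/eqP : FA0 => ->.
  by rewrite ediam0 add0e; apply: le_ediam; exact: subIsetl.
have [[y [Fy By]]|FB0] := pselect (F k `&` B !=set0); last first.
  move/set0P/negP/negPn/eqP : FB0 => ->.
  by rewrite ediam0 adde0; apply: le_ediam; exact: subIsetl.
exfalso; have := le_trans (enorm_le_ediam Fx Fy) (dF k).
by rewrite lee_fin leNgt (lt_le_trans de)// sepAB.
Qed.

Lemma hausdorff1_separated A B (e : R) : (0 < e)%R ->
  (forall x y, A x -> B y -> (e <= enorm (x - y))%R) ->
  hausdorff1 A + hausdorff1 B <= hausdorff1 (A `|` B).
Proof.
move=> e0 sepAB.
have [->|ABoo] := eqVneq (hausdorff1 (A `|` B)) +oo; first exact: leey.
have fin C : C `<=` A `|` B -> hausdorff1 C \is a fin_num.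
  move=> CAB; rewrite ge0_fin_numE ?hausdorff1_ge0//.
  by rewrite (le_lt_trans (le_hausdorff1 CAB))// ltey.
have fABn : hausdorff1 (A `|` B) \is a fin_num by exact: fin.
have fB : hausdorff1 B \is a fin_num by apply: fin => ?; right.
rewrite -leeBrDr//; apply: ge_ereal_sup => _ [d /= d0 <-].
have fdA : hausdorff1_delta d A \is a fin_num.
  rewrite ge0_fin_numE ?hausdorff1_delta_ge0//.
  apply: (@le_lt_trans _ _ (hausdorff1 (A `|` B))); last by rewrite ltey.
  apply: (@le_trans _ _ (hausdorff1_delta d (A `|` B))).
    by apply: le_hausdorff1_delta => ?; left.
  by apply: ereal_sup_ubound; exists d.
rewrite leeBrDr// addeC -leeBrDr//; apply: ge_ereal_sup => _ [d' /= d'0 <-].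
rewrite leeBrDr// addeC.
(* A common scale: below [d] and [d'], so that both terms only grow, and below [e], so that the
   separation applies. *)
pose m := Num.min (Num.min d d') (e / 2)%R.
have m0 : (0 < m)%R by rewrite !lt_min d0 d'0 divr_gt0.
apply: (@le_trans _ _ (hausdorff1_delta m (A `|` B))); last first.
  by apply: ereal_sup_ubound; exists m.
apply: le_trans; last first.
  apply: hausdorff1_delta_separated sepAB.
  by rewrite !gt_min [X in _ || X](_ : _ = true) ?orbT//; lra.
by apply: leeD; apply: hausdorff1_delta_anti; rewrite /m !ge_min lexx ?orbT.
Qed.

(* Caratheodory's criterion: [H (A n) + H (T n) <= H (T n.+2)] for the shells
   [A n], so the tails of [\sum_n H (A n)] are controlled by a telescoping sum. *)
Lemma lipschitz_hausdorff1_measurable (g : 'rV[R]_n -> R) (C c : R) : (0 < C)%R ->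
  (forall x y, (`|g x - g y| <= C * enorm (x - y))%R) ->
  hausdorff1.-cara.-measurable [set x | (g x <= c)%R].
Proof.
move=> C0 gC; pose E := [set x | (g x <= c)%R].
apply: le_caratheodory_measurable => X.
change (hausdorff1 (X `&` E) + hausdorff1 (X `&` ~` E) <= hausdorff1 X).
have [->|Xoo] := eqVneq (hausdorff1 X) +oo; first exact: leey.
have fin Y : Y `<=` X -> hausdorff1 Y \is a fin_num.
  move=> YX; rewrite ge0_fin_numE ?hausdorff1_ge0//.
  by rewrite (le_lt_trans (le_hausdorff1 YX))// ltey.
(* By the Lipschitz bound, points with [g <= s] and [g >= t] are at distance at least
   [(t - s) / C]. *)
have sep Y Z (s t : R) : (s < t)%R -> (forall x, Y x -> g x <= s)%R ->
    (forall x, Z x -> t <= g x)%R ->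
    hausdorff1 Y + hausdorff1 Z <= hausdorff1 (Y `|` Z).
  move=> st Ys Zt; apply: (@hausdorff1_separated _ _ ((t - s) / C)%R).
    by rewrite divr_gt0// subr_gt0.
  move=> x y Yx Zy; rewrite ler_pdivrMr// mulrC.
  apply: le_trans (gC x y); rewrite distrC.
  by apply: le_trans (ler_norm _); apply: lerB; [exact: Zt|exact: Ys].
pose a k : R := (k.+1%:R^-1)%R.
have aS k : (a k.+1 < a k)%R by rewrite ltf_pV2 ?posrE// ltr_nat.
have a0 k : (0 < a k)%R by rewrite invr_gt0.
set P := X `&` _; set Q := X `&` _.
(* The shell [A k] is kept apart from [T k] by the levels between [c + a k.+1] and [c + a k]. *)
pose T k := Q `&` [set x | (c + a k <= g x)%R].
pose A k := Q `&` [set x | (c + a k.+2 <= g x < c + a k.+1)%R].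
have QX : Q `<=` X by move=> x [].
have TX k : T k `<=` X by move=> x [/QX].
have AX k : A k `<=` X by move=> x [/QX].
have TS k : T k `<=` T k.+1.
  by move=> x [Qx /= h]; split=> //=; apply: le_trans h; rewrite lerD2l ltW.
have PT k : hausdorff1 P + hausdorff1 (T k) <= hausdorff1 X.
  apply: (@le_trans _ _ (hausdorff1 (P `|` T k))).
    apply: (@sep _ _ c (c + a k)%R); first by rewrite ltrDl.
      by move=> x [].
    by move=> x [].
  by apply: le_hausdorff1 => x [[]|/TX].
have AT k : hausdorff1 (A k) + hausdorff1 (T k) <= hausdorff1 (T k.+2).
  apply: (@le_trans _ _ (hausdorff1 (A k `|` T k))).
    apply: (@sep _ _ (c + a k.+1)%R (c + a k)%R); first by rewrite ltrD2l.
      by move=> x [_ /= /andP[_ /ltW]].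
    by move=> x [].
  by apply: le_hausdorff1 => x [[Qx /= /andP[]]|/TS/TS].
pose tau k := fine (hausdorff1 (T k)).
have tauE k : (tau k)%:E = hausdorff1 (T k) by rewrite fineK// fin.
pose alp k := fine (hausdorff1 (A k)).
have alpE k : (alp k)%:E = hausdorff1 (A k) by rewrite fineK// fin.
have tauS k : (tau k <= tau k.+1)%R.
  by rewrite -lee_fin !tauE; exact: le_hausdorff1.
have tau_le k l : (k <= l)%N -> (tau k <= tau l)%R.
  by move=> /subnK <-; elim: (l - k)%N => // i /le_trans; apply; exact: tauS.
have tau_ub : has_ubound (range tau).
  exists (fine (hausdorff1 X)) => _ [k _ <-].
  by apply: fine_le; rewrite ?fin//; exact: le_hausdorff1.
pose L := sup (range tau).
have tauL k : (tau k <= L)%R by apply: ub_le_sup => //; exists k.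
apply/lee_addgt0Pr => e e0.
have e20 : (0 < e / 2)%R by rewrite divr_gt0.
have sup_tau : has_sup (range tau) by split => //; exists (tau 0%N), 0%N.
have [_ [k _ <-] Lk] := sup_adherent e20 sup_tau.
have QTA : Q `<=` T k.+1 `|` \bigcup_i A (k + i)%N.
  move=> x Qx; have [h|h] := leP (c + a k.+1)%R (g x); first by left.
  have gxc : (0 < g x - c)%R.
    by case: Qx => _ /=; rewrite subr_gt0; move/negP; rewrite ltNge.
  have exk : exists i, (c + a (k + i).+2 <= g x)%R.
    exists (Num.truncn (g x - c)^-1); rewrite -lerBrDl -[leRHS]invrK.
    rewrite lef_pV2 ?posrE ?invr_gt0//.
    rewrite (le_trans (ltW (truncnS_gt _)))// ler_nat.
    by rewrite ltnS; do 2 apply: leqW; exact: leq_addl.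
  right; have [i gi mini] := ex_minnP exk.
  exists i => //; split=> //=; rewrite gi/=.
  case: i gi mini => [|i] _ mini; first by rewrite addn0.
  rewrite ltNge; apply/negP => h'; have := mini i.
  by rewrite addnS in h'; move=> /(_ h'); rewrite ltnn.
(* [AT] links indices two apart, so its sum telescopes in two interleaved chains. All [tau] are at
   most [L] and [tau k > L - e / 2], so the tail is at most [e]. *)
have sumA N : (\sum_(0 <= i < N) alp (k + i)%N <=
    tau (k + N).+1 + tau (k + N)%N - tau k.+1 - tau k)%R.
  elim: N => [|N IH]; first by rewrite big_nil addn0; lra.
  rewrite big_nat_recr//= addnS.
  have : (alp (k + N)%N + tau (k + N)%N <= tau (k + N).+2)%R.
    by rewrite -lee_fin EFinD alpE !tauE.
  by lra.
have HQ : hausdorff1 Q <= (tau k.+1)%:E + e%:E.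
  apply: le_trans (le_hausdorff1 QTA) _.
  apply: le_trans (outer_measureU2 hausdorff1 _ _) _.
  rewrite tauE leeD2l//.
  apply: le_trans (outer_measure_sigma_subadditive hausdorff1 _) _.
  apply: nneseries_le_ub => [i|N]; first exact: hausdorff1_ge0.
  rewrite (eq_bigr (fun i => (alp (k + i)%N)%:E)); last by move=> i _; rewrite alpE.
  rewrite sumEFin lee_fin; apply: le_trans (sumA N) _.
  have := tauL (k + N)%N; have := tauL (k + N).+1; have := tauS k.
  by rewrite -/L in Lk; lra.
apply: (@le_trans _ _ (hausdorff1 P + ((tau k.+1)%:E + e%:E))).
  by rewrite leeD2l.
by rewrite addeA tauE leeD2r.
Qed.

(** The images of [N + 1] equal subintervals have diameter at most [C h <= d], and their total is at
    most [C (b - a)] whatever [d] is. *)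
Lemma hausdorff1_lipschitz_le (u : R -> 'rV[R]_n) (a b C : R) :
  (a <= b)%R -> (0 <= C)%R ->
  (forall s t, a <= s <= b -> a <= t <= b ->
    enorm (u s - u t) <= C * `|s - t|)%R ->
  hausdorff1 [set u t | t in `[a, b]] <= (C * (b - a))%:E.
Proof.
move=> ab C0 uC; apply: ge_ereal_sup => _ [d /= d0 <-].
pose N := Num.truncn (C * (b - a) / d); pose h := ((b - a) / N.+1%:R)%R.
have h0 : (0 <= h)%R by rewrite divr_ge0// subr_ge0.
have Nh : (N.+1%:R * h = b - a)%R by rewrite mulrC divfK.
have Ch0 : (0 <= C * h)%R by rewrite mulr_ge0.
have Chd : (C * h <= d)%R.
  rewrite /h mulrA ler_pdivrMr// [leRHS]mulrC -ler_pdivrMr//.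
  exact/ltW/truncnS_gt.
pose I k := [set t : R | (a <= t <= b)%R /\ (a + k%:R * h <= t <= a + k.+1%:R * h)%R].
pose F k := if (k <= N)%N then u @` I k else set0.
have Fd k : ediam (F k) <= (if (k <= N)%N then (C * h)%:E else 0).
  rewrite /F; case: ifPn => _; last by rewrite ediam0.
  apply: ediam_le => // _ _ [s [sab /andP[s1 s2]] <-] [t [tab /andP[t1 t2]] <-].
  apply: le_trans (uC _ _ sab tab) _; rewrite ler_wpM2l//.
  rewrite ler_norml; move: s2 t2; rewrite -natr1 mulrDl mul1r; lra.
apply: (@le_trans _ _ (\sum_(k <oo) ediam (F k))).
  apply: ereal_inf_lbound; exists F => //; split; last first.
    by move=> k; apply: le_trans (Fd k) _; case: ifPn; rewrite lee_fin// ltW.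
  move=> _ [t /= tab <-]; move: (tab); rewrite in_itv/= => tab'.
  have exk : exists k, (t <= a + k.+1%:R * h)%R.
    by exists N; rewrite Nh addrC subrK; case/andP: tab'.
  have [k tk mink] := ex_minnP exk.
  have kN : (k <= N)%N.
    by apply: mink; rewrite Nh addrC subrK; case/andP: tab'.
  exists k => //; rewrite /F kN; exists t => //; split=> //; rewrite tk andbT.
  case: k {kN} tk mink => [|k] tk mink.
    by rewrite mul0r addr0; case/andP: tab'.
  by rewrite leNgt; apply/negP => /ltW/mink; rewrite ltnn.
apply: nneseries_le_ub => [k|M]; first exact: ediam_ge0.
have : \sum_(0 <= k < M) ediam (F k) <= ((minn M N.+1)%:R * (C * h))%:E.
  elim: M => [|M IH]; first by rewrite big_nil min0n mul0r.
  rewrite big_nat_recr//=.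
  apply: le_trans (leeD IH (Fd M)) _; case: ifPn => MN.
    by rewrite (minn_idPl _) 1?ltnW// (minn_idPl _)// -EFinD -natr1 mulrDl mul1r.
  rewrite -ltnNge in MN.
  by rewrite adde0 (minn_idPr MN) (minn_idPr (ltnW _)).
move/le_trans; apply; rewrite lee_fin mulrCA ler_wpM2l// -Nh ler_wpM2r//.
by rewrite ler_nat geq_minr.
Qed.

Lemma hausdorff1_set1 x : hausdorff1 [set x] = 0.
Proof.
apply/eqP; rewrite eq_le hausdorff1_ge0 andbT.
have : hausdorff1 [set (fun=> x) t | t in `[0%R, 0%R : R]] <= (0 * (0 - 0))%:E.
  apply: hausdorff1_lipschitz_le => // s t _ _.
  by rewrite subrr /enorm /dotp big1 ?sqrtr0 ?mul0r// => i _; rewrite mxE mul0r.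
rewrite mul0r; apply: le_trans; apply: le_hausdorff1 => _ ->.
by exists 0%R => //=; rewrite in_itv/= lexx.
Qed.

End arbitrary_dimension.
End hausdorff_theory.

(** * Chords and half-planes *)

Section real_intervals.
Context {R : realType}.

Lemma cousin (P : R -> R -> Prop) (a b : R) : a <= b ->
  (forall r s t, r <= s <= t -> P r s -> P s t -> P r t) ->
  (forall t, a <= t <= b -> exists2 e, 0 < e &
    forall r s, t - e < r <= t -> t <= s < t + e -> P r s) ->
  P a b.
Proof.
move=> ab Ptrans Ploc.
pose E := [set t | a <= t <= b /\ P a t].
(* The local hypothesis includes the degenerate interval [r = s = t], which yields [P a a]. *)
have Ea : E a.
  split; first by rewrite lexx.
  have [|e e0 Pe] := Ploc a; first by rewrite lexx.
  by apply: Pe; rewrite ?lexx; lra.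
have supE : has_sup E by split; [exists a|exists b => t [/andP[]]].
pose c := sup E.
have ac : a <= c by apply: ub_le_sup => //; case: supE.
have cb : c <= b by apply: ge_sup; [exists a|move=> t [/andP[]]].
have [|e e0 Pe] := Ploc c; first by rewrite ac.
have [r [/andP[ar rb] Par] cr] := sup_adherent e0 supE.
have rc : r <= c by apply: ub_le_sup; [case: supE|split; [rewrite ar|]].
have step s : c <= s < c + e -> P a s.
  move=> cs; have [cs1 _] := andP cs.
  apply: (Ptrans _ r) => //; first by rewrite ar (le_trans rc).
  by apply: Pe => //; rewrite cr.
have [bc|cb'] := leP b c.
  by apply: step; apply/andP; split=> //; lra.
pose s := Num.min b (c + e / 2).
have cs : c < s by rewrite lt_min cb' ltrDl divr_gt0.
have : s <= c.
  apply: ub_le_sup; first by case: supE.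
  split; first by rewrite (le_trans ac (ltW cs)) ge_min lexx.
  apply: step; rewrite (ltW cs)/= gt_min; apply/orP; right; lra.
by rewrite leNgt cs.
Qed.

(** The interval contains [t] instead of starting there: the increments on either side of [t] have
    errors at most [e (s - t)] and [e (t - r)], which add up to [e (s - r)]. This is the local form
    needed by [cousin]. *)
Lemma is_derive_straddle (W : R -> R) (t d e : R) : 0 < e -> is_derive t 1 W d ->
  exists2 eta, 0 < eta & forall r s, t - eta < r <= t -> t <= s < t + eta ->
    `|W s - W r - d * (s - r)| <= e * (s - r).
Proof.
move=> e0 [dW <-].
have /cvgrPdist_le /(_ e e0) := dW.
move=> /nbhs_ballP[eta /= eta0 H]; exists eta => //.
have close s : `|s - t| < eta -> `|W s - W t - 'D_1 W t * (s - t)| <= e * `|s - t|.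
  have [->|st] := eqVneq s t; first by rewrite !subrr mulr0 subr0 normr0 mulr0.
  move=> ste; have st0 : s - t != 0 by rewrite subr_eq0.
  have := H (s - t); rewrite /ball/= sub0r normrN => /(_ ste st0).
  rewrite /GRing.scale/= mulr1 subrK => H'.
  have -> : W s - W t - 'D_1 W t * (s - t) =
      - (('D_1 W t - (s - t)^-1 * (W s - W t)) * (s - t)).
    by field.
  by rewrite normrN normrM ler_wpM2r.
move=> r s /andP[r1 r2] /andP[s1 s2].
have Hr : `|r - t| < eta by rewrite ler0_norm ?subr_le0//; lra.
have Hs : `|s - t| < eta by rewrite ger0_norm ?subr_ge0//; lra.
have -> : W s - W r - 'D_1 W t * (s - r) = (W s - W t - 'D_1 W t * (s - t)) -
   (W r - W t - 'D_1 W t * (r - t)) by ring.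
apply: le_trans (ler_normB _ _) _.
apply: le_trans (lerD (close _ Hs) (close _ Hr)) _.
rewrite ger0_norm ?subr_ge0// ler0_norm ?subr_le0//; lra.
Qed.

End real_intervals.

Section plane.
Context {R : realType}.
Implicit Types (u v w x y m e : 'rV[R]_2) (s t : R).

Definition det2 x y : R := x 0 0 * y 0 1 - x 0 1 * y 0 0.

Lemma dotp2E x y : dotp x y = x 0 0 * y 0 0 + x 0 1 * y 0 1.
Proof.
rewrite /dotp !big_ord_recl big_ord0 addr0.
by rewrite (_ : lift _ _ = 1)//; apply/val_inj.
Qed.

Lemma eq_rV2 x y : x 0 0 = y 0 0 -> x 0 1 = y 0 1 -> x = y.
Proof.
move=> xy0 xy1; apply/rowP => i.
have [->//|i1] := eqVneq i 0.
rewrite (_ : i = 1)//; apply/val_inj.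
by case: i i1 => [[|[|?]]].
Qed.

Lemma dotp_ge0 x : 0 <= dotp x x.
Proof. by rewrite dotp2E addr_ge0// -expr2 sqr_ge0. Qed.

Lemma dotp_eq0 x : (dotp x x == 0) = (x == 0).
Proof.
apply/eqP/eqP => [|->]; last by rewrite dotp2E !mxE !mul0r addr0.
rewrite dotp2E -!expr2 => /eqP; rewrite paddr_eq0 ?sqr_ge0// !sqrf_eq0.
by move=> /andP[/eqP x0 /eqP x1]; apply: eq_rV2; rewrite mxE.
Qed.

Lemma dotp_gt0 x : (0 < dotp x x) = (x != 0).
Proof. by rewrite lt_neqAle dotp_ge0 andbT eq_sym dotp_eq0. Qed.

Lemma enorm_ge0 x : 0 <= enorm x.
Proof. exact: sqrtr_ge0. Qed.

Lemma sqr_enorm x : enorm x ^+ 2 = dotp x x.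
Proof. by rewrite sqr_sqrtr// dotp_ge0. Qed.

Lemma enorm_gt0 x : (0 < enorm x) = (x != 0).
Proof. by rewrite sqrtr_gt0 dotp_gt0. Qed.

Lemma enormZ (c : R) x : enorm (c *: x) = `|c| * enorm x.
Proof.
rewrite /enorm (_ : dotp _ _ = c ^+ 2 * dotp x x).
  by rewrite sqrtrM ?sqr_ge0// sqrtr_sqr.
by rewrite !dotp2E !mxE; ring.
Qed.

(** Lagrange's identity in the plane, the source of Cauchy-Schwarz and of its strict form when the
    determinant is nonzero. *)
Lemma dotp_det2 x y : dotp x y ^+ 2 + det2 x y ^+ 2 = dotp x x * dotp y y.
Proof. by rewrite !dotp2E /det2; ring. Qed.

Lemma cauchy_schwarz x y : `|dotp x y| <= enorm x * enorm y.
Proof.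
rewrite -(@ler_pXn2r _ 2)// ?nnegrE ?mulr_ge0 ?enorm_ge0//.
by rewrite exprMn !sqr_enorm real_normK ?num_real// -dotp_det2 lerDl sqr_ge0.
Qed.

Lemma enorm_dist x y : `|enorm x - enorm y| <= enorm (x - y).
Proof.
rewrite -(@ler_pXn2r _ 2)// ?nnegrE ?enorm_ge0//.
rewrite real_normK ?num_real// sqrrB !sqr_enorm.
have := le_trans (ler_norm _) (cauchy_schwarz x y).
by rewrite !dotp2E !mxE; lra.
Qed.

Lemma dotp_dist v x y : `|dotp v x - dotp v y| <= enorm v * enorm (x - y).
Proof.
by apply: le_trans (cauchy_schwarz v (x - y)); rewrite !dotp2E !mxE !mulrBr opprD addrACA.
Qed.

Local Notation H1 := (@hausdorff1 R 2).

Lemma measurable_halfplane v (c : R) :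
  H1.-cara.-measurable [set x | dotp v x <= c].
Proof.
apply: (@lipschitz_hausdorff1_measurable _ _ _ (enorm v + 1)).
  by rewrite ltr_wpDl ?enorm_ge0.
move=> x y; apply: le_trans (dotp_dist v x y) _.
by rewrite ler_wpM2r ?enorm_ge0// lerDl.
Qed.

Lemma measurable_dotp v :
  measurable_fun setT (dotp v : caratheodory_type H1 -> R).
Proof.
apply: (measurability _ (RGenOInfty.measurableE R)) => //.
move=> _ [_ [c ->] <-]; rewrite setTI.
rewrite (_ : _ @^-1` _ = ~` [set x | dotp v x <= c]).
  by apply: measurableC; exact: measurable_halfplane.
apply/seteqP; split=> x /=; rewrite in_itv/= andbT ltNge => /negP //.
Qed.

Lemma measurable_usphere : H1.-cara.-measurable (@usphere R 2).
Proof.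
rewrite (_ : usphere = [set x | enorm x <= 1] `&` [set x | - enorm x <= -1]).
  apply: measurableI.
    apply: (@lipschitz_hausdorff1_measurable _ _ _ 1) => // x y.
    by rewrite mul1r enorm_dist.
  apply: (@lipschitz_hausdorff1_measurable _ _ _ 1) => // x y.
  by rewrite mul1r -opprD normrN enorm_dist.
apply/seteqP; split=> x /=; rewrite /usphere /= lerN2.
  by move=> ->; rewrite !lexx.
by move=> [h1 h2]; apply/le_anti; rewrite h1 h2.
Qed.

(** The interval runs from the infimum to the supremum of [p] on [A]. It turns a cover of a plane
    set into a cover of its projection of no greater total length. *)
Lemma le_lebesgue_ediam (A : set 'rV[R]_2) (p : 'rV[R]_2 -> R) :
  (forall x y, `|p x - p y| <= enorm (x - y)) ->
  (ediam A \is a fin_num)%E ->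
  exists2 I : set R, (measurable I /\ (lebesgue_measure I <= ediam A)%E) &
    [set p x | x in A] `<=` I.
Proof.
move=> plip finA.
have [A0|/set0P/negP/negPn/eqP ->] := pselect (A !=set0); last first.
  exists set0; last by rewrite image_set0.
  by split=> //; rewrite measure0 ediam0.
pose d := fine (ediam A).
have pd x y : A x -> A y -> p x - p y <= d.
  move=> Ax Ay; apply: le_trans (ler_norm _) (le_trans (plip _ _) _).
  by rewrite -lee_fin fineK// enorm_le_ediam.
have [z Az] := A0.
have pA0 : (p @` A) !=set0 by exists (p z), z.
have ubA : has_ubound (p @` A).
  by exists (p z + d) => _ [x Ax <-]; rewrite -lerBlDl pd.
have lbA : has_lbound (p @` A).
  by exists (p z - d) => _ [x Ax <-]; rewrite lerBlDl -lerBlDr pd.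
exists `[inf (p @` A), sup (p @` A)]%classic; last first.
  move=> y Ay; rewrite /= in_itv/=; apply/andP; split.
    exact: ge_inf.
  exact: ub_le_sup.
split=> //; rewrite lebesgue_measure_itv/=.
have dE : ediam A = d%:E by rewrite fineK.
case: ifPn => _; last by rewrite ediam_ge0.
rewrite dE -EFinD lee_fin lerBlDr.
apply: ge_sup => // _ [x Ax <-]; rewrite -lerBlDl.
apply: lb_le_inf => // _ [y Ay <-].
by rewrite lerBlDr -lerBlDl pd.
Qed.

(** Projection to the direction of the chord is 1-Lipschitz, and by the intermediate value theorem
    the projected curve covers []0, l]]; hence every cover of the curve has total diameter at least
    [l]. *)
Lemma hausdorff1_chord_ge (u : R -> 'rV[R]_2) (a b : R) : a <= b ->
  (forall v, {within `[a, b], continuous (fun t => dotp v (u t))}) ->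
  ((enorm (u b - u a))%:E <= hausdorff1 [set u t | t in `]a, b]])%E.
Proof.
move=> ab uc; pose l := enorm (u b - u a).
have [l0|l0] := eqVneq l 0; first by rewrite -/l l0 hausdorff1_ge0.
have {}l0 : 0 < l by rewrite lt_neqAle eq_sym l0 enorm_ge0.
pose v := l^-1 *: (u b - u a).
pose p x := dotp v x - dotp v (u a).
have v1 : enorm v = 1 by rewrite enormZ ger0_norm ?invr_ge0 ?(ltW l0)// mulVf// gt_eqF.
have plip x y : `|p x - p y| <= enorm (x - y).
  rewrite /p opprB addrA subrK -[leRHS]mul1r -v1; exact: dotp_dist.
have pb : p (u b) = l.
  have : dotp (u b - u a) (u b - u a) = l ^+ 2 by rewrite sqr_enorm.
  move=> El; rewrite /p.
  have -> : dotp v (u b) - dotp v (u a) = l^-1 * dotp (u b - u a) (u b - u a).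
    by rewrite !dotp2E !mxE; ring.
  by rewrite El expr2 mulKf// gt_eqF.
have pa : p (u a) = 0 by rewrite /p subrr.
set A := [set u t | t in _].
have cover : `]0, l]%classic `<=` p @` A.
  move=> y /=; rewrite in_itv/= => /andP[y0 yl].
  have [||c cab pc] := @IVT R (fun t => p (u t)) a b y ab.
  - by move=> t; apply: cvgB; [exact: (uc v)|exact: cvg_cst].
  - by rewrite pa pb min_l ?max_r ?(ltW l0)// (ltW y0).
  exists (u c) => //; exists c => //.
  move: cab; rewrite in_itv/= => /andP[ac cb].
  rewrite /= in_itv/= cb andbT lt_neqAle ac andbT.
  by apply/negP => /eqP ca; move: y0; rewrite -pc -ca pa ltxx.
(* The scale [1] only serves to make the diameters in the cover finite; any positive value would
   do. *)
apply: (@le_trans _ _ (hausdorff1_delta 1 A)); last first.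
  by apply: ereal_sup_ubound; exists 1%R => //=.
apply: le_ereal_inf_tmp => _ [F [AF dF] <-].
have fF k : (ediam (F k) \is a fin_num)%E.
  rewrite ge0_fin_numE ?ediam_ge0//.
  by rewrite (le_lt_trans (dF k))// ltry.
have HI k := le_lebesgue_ediam plip (fF k).
pose I k := sval (cid2 (HI k)).
have mI k : measurable (I k) by rewrite /I; case: cid2 => ? [].
have lI k : (lebesgue_measure (I k) <= ediam (F k))%E.
  by rewrite /I; case: cid2 => ? [].
have pI k : p @` F k `<=` I k by rewrite /I; case: cid2.
have -> : (enorm (u b - u a))%:E = lebesgue_measure (`]0, l]%classic : set R).
  by rewrite lebesgue_measure_itv/= lte_fin l0 -EFinB subr0.
apply: (@le_trans _ _ (\sum_(k <oo) lebesgue_measure (I k))%E); last first.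
  by apply: lee_nneseries => // k _; exact: lI.
apply: measure_sigma_subadditive => // y /cover[x Ax <-].
by have [k _ Fkx] := AF _ Ax; exists k => //; apply: pI; exists x.
Qed.

End plane.

(** * Integrals over circular arcs *)

Section lower_integral.
Local Open Scope ereal_scope.

(** The integral of a nonnegative function is a supremum over the simple functions below its
    extension by 0, so monotonicity holds for arbitrary sets and integrands. Comparisons involving
    [radial_fun] or the reverse radial Gauss image rest on this. *)
Lemma ge0_le_subset_integral (d : measure_display) (T : measurableType d)
    (R : realType) (mu : {measure set T -> \bar R}) (A B : set T)
    (f g : T -> \bar R) :
  A `<=` B -> (forall x, A x -> 0 <= f x) -> (forall x, B x -> 0 <= g x) ->
  (forall x, A x -> f x <= g x) ->
  \int[mu]_(x in A) f x <= \int[mu]_(x in B) g x.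
Proof.
move=> AB f0 g0 fg; rewrite !ge0_integralE//.
apply: ereal_sup_le => _ [h hf <-]; exists h => // x.
apply: le_trans (hf x) _; rewrite /patch.
case: ifPn => [/set_mem Ax|_].
  by rewrite mem_set ?fg//; exact: AB.
by case: ifPn => // /set_mem; exact: g0.
Qed.

End lower_integral.

Section arcs.
Context {R : realType}.
Implicit Types (u v w x y m e : 'rV[R]_2) (s t : R).
Local Notation H1 := (@hausdorff1 R 2).

Definition row2 (a b : R) : 'rV[R]_2 := \row_i (if i == 0 then a else b).

(* The coordinates in the basis [(m, e)], written as linear forms so that
   [measurable_dotp] applies. *)
Definition coord1 m e v : R :=
  dotp ((det2 m e)^-1 *: row2 (e 0 1) (- e 0 0)) v.

Definition coord2 m e v : R :=
  dotp ((det2 m e)^-1 *: row2 (- m 0 1) (m 0 0)) v.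

Lemma coord1E m e v : coord1 m e v = det2 v e / det2 m e.
Proof. by rewrite /coord1 dotp2E !mxE/= /det2; ring. Qed.

Lemma coord2E m e v : coord2 m e v = det2 m v / det2 m e.
Proof. by rewrite /coord2 dotp2E !mxE/= /det2; ring. Qed.

Lemma coordK m e v : det2 m e != 0 -> v = coord1 m e v *: m + coord2 m e v *: e.
Proof.
rewrite coord1E coord2E /det2 => D0.
by apply: eq_rV2; rewrite !mxE; field.
Qed.

Lemma coord1_comb m e (a b : R) : det2 m e != 0 ->
  coord1 m e (a *: m + b *: e) = a.
Proof. by rewrite coord1E /det2 !mxE => D0; field. Qed.

Lemma coord2_comb m e (a b : R) : det2 m e != 0 ->
  coord2 m e (a *: m + b *: e) = b.
Proof. by rewrite coord2E /det2 !mxE => D0; field. Qed.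

Lemma measurable_lincomb_coord m e (a b : R) :
  H1.-cara.-measurable [set v | a * coord1 m e v + b * coord2 m e v <= 0].
Proof.
pose w := a *: ((det2 m e)^-1 *: row2 (e 0 1) (- e 0 0)) +
  b *: ((det2 m e)^-1 *: row2 (- m 0 1) (m 0 0)).
rewrite (_ : [set v | _] = [set v | dotp w v <= 0]).
  exact: measurable_halfplane.
apply/seteqP; split=> v /=; rewrite /coord1 /coord2 /w !dotp2E !mxE/=; lra.
Qed.

(** Directions whose slope [coord2 / coord1] lies in []s, t]], with denominators cleared so that
    half-planes cut the set out of the circle. Being half-open makes consecutive arcs disjoint. *)
Definition arc m e s t : set 'rV[R]_2 := [set v | usphere v /\
  (0 < coord1 m e v /\ s * coord1 m e v < coord2 m e v <= t * coord1 m e v)].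

Lemma measurable_arc m e s t : H1.-cara.-measurable (arc m e s t).
Proof.
rewrite (_ : arc m e s t = usphere `&`
  (~` [set v | 1 * coord1 m e v + 0 * coord2 m e v <= 0] `&`
   (~` [set v | (- s) * coord1 m e v + 1 * coord2 m e v <= 0] `&`
    [set v | (- t) * coord1 m e v + 1 * coord2 m e v <= 0]))).
  by do ?[apply: measurableI]; do ?[apply: measurableC];
    [exact: measurable_usphere|exact: measurable_lincomb_coord..].
apply/seteqP; split=> v /=.
  move=> [Sv [c0 /andP[c1 c2]]]; split=> //; split; first by apply/negP; lra.
  by split; [apply/negP|]; lra.
move=> [Sv [/negP c0 [/negP c1 c2]]]; split=> //; split; first lra.
by apply/andP; split; lra.
Qed.

Definition edge m e s := m + s *: e.

Definition sphere_proj x := (enorm x)^-1 *: x.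

Lemma usphere_sphere_proj x : x != 0 -> usphere (sphere_proj x).
Proof.
rewrite -enorm_gt0 => x0; rewrite /usphere/= enormZ ger0_norm ?invr_ge0 ?enorm_ge0//.
by rewrite mulVf// gt_eqF.
Qed.

Section fixed_basis.
Variables (m e : 'rV[R]_2).
Hypothesis D0 : det2 m e != 0.
Let X := dotp m m.
Let Y := dotp e e.
Let B := dotp m e.
Let f s := X + 2 * B * s + Y * s ^+ 2.
Let l s := enorm (edge m e s).
Let u s := sphere_proj (edge m e s).

Lemma det2_dotp_gt0 : 0 < dotp m m.
Proof.
rewrite dotp_gt0; apply: contra D0 => /eqP ->.
by rewrite /det2 !mxE !mul0r subrr.
Qed.

Lemma det2_cauchy_schwarz : dotp m e ^+ 2 < dotp m m * dotp e e.
Proof. by rewrite -dotp_det2 ltrDl exprn_even_gt0. Qed.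

Lemma sqr_enorm_edge s : enorm (edge m e s) ^+ 2 =
  dotp m m + 2 * dotp m e * s + dotp e e * s ^+ 2.
Proof. by rewrite sqr_enorm !dotp2E !mxE; ring. Qed.

Let f0 s : 0 < f s.
Proof. exact: quadratic_gt0 det2_dotp_gt0 det2_cauchy_schwarz. Qed.

Let lf s : l s ^+ 2 = f s. Proof. exact: sqr_enorm_edge. Qed.

Let l0 s : 0 < l s.
Proof. by rewrite lt_neqAle enorm_ge0 andbT eq_sym -sqrf_eq0 lf gt_eqF. Qed.

Let edge0 s : edge m e s != 0. Proof. by rewrite -enorm_gt0; exact: l0. Qed.

Let uE s : u s = (l s)^-1 *: m + ((l s)^-1 * s) *: e.
Proof. by rewrite /u /sphere_proj /edge scalerDr scalerA. Qed.

Lemma coord1_sphere_proj_edge s : coord1 m e (u s) = (l s)^-1.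
Proof. by rewrite uE coord1_comb. Qed.

Lemma arcE s t : arc m e s t = [set u r | r in `]s, t]].
Proof.
apply/seteqP; split=> [v [Sv [c0 /andP[c1 c2]]]|_ [r /= + <-]]; last first.
  rewrite in_itv/= => /andP[sr rt]; split; first exact: usphere_sphere_proj.
  have li : 0 < (l r)^-1 by rewrite invr_gt0.
  rewrite uE coord1_comb// coord2_comb//; split=> //.
  by rewrite [_^-1 * r]mulrC ltr_pM2r// ler_pM2r// sr rt.
pose r := coord2 m e v / coord1 m e v.
exists r; first by rewrite /= in_itv/= ltr_pdivlMr// ler_pdivrMr// c1 c2.
have vE : v = coord1 m e v *: edge m e r.
  by rewrite {1}(coordK v D0) /edge scalerDr scalerA /r [_ * (_ / _)]mulrC divfK// gt_eqF.
have c1l : coord1 m e v * l r = 1.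
  by have : enorm v = 1 by []; rewrite {1}vE enormZ ger0_norm// ltW.
have lr0 : l r != 0 by exact/lt0r_neq0/l0.
rewrite vE /u /sphere_proj; congr (_ *: _).
by apply: (mulIf lr0); rewrite mulVf.
Qed.

(** The chord length divided by [|s - t|], with [(l s - l t) / (s - t)] rewritten as
    [(2 B + Y (s + t)) / (l s + l t)], which remains continuous at [s = t]. *)
Let ratio (p : R * R) : R :=
  Num.sqrt ((Y - ((2 * B + Y * (p.1 + p.2)) / (l p.1 + l p.2)) ^+ 2) /
            (l p.1 * l p.2)).

(* With [x] and [y] the points of the edge, the squared chord is
   [(|x - y|^2 - (|x| - |y|)^2) / (|x| |y|)]. *)
Let enorm_chord s t : enorm (u s - u t) = `|s - t| * ratio (s, t).
Proof.
rewrite /ratio -[`|s - t|]sqrtr_sqr -sqrtrM ?sqr_ge0//; congr Num.sqrt.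
have hs := lf s; have ht := lf t; have ls := l0 s; have lt := l0 t.
rewrite !uE /=; move: (l s) (l t) hs ht ls lt => a b ha hb a0 b0.
have aN0 : a != 0 by rewrite gt_eqF.
have bN0 : b != 0 by rewrite gt_eqF.
have ab0 : a + b != 0 by rewrite gt_eqF// addr_gt0.
have -> : dotp (a^-1 *: m + (a^-1 * s) *: e - (b^-1 *: m + (b^-1 * t) *: e))
  (a^-1 *: m + (a^-1 * s) *: e - (b^-1 *: m + (b^-1 * t) *: e)) =
  f s / a ^+ 2 + f t / b ^+ 2 - 2 * (X + B * (s + t) + Y * s * t) / (a * b).
  by rewrite /f /X /B /Y !dotp2E !mxE; field; rewrite bN0.
have key : (s - t) * (2 * B + Y * (s + t)) = a ^+ 2 - b ^+ 2.
  by rewrite ha hb /f; ring.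
rewrite -ha -hb !divff ?expf_neq0// mulrA mulrBr -exprMn mulrA key.
have -> : (a ^+ 2 - b ^+ 2) / (a + b) = a - b by field.
have -> : (s - t) ^+ 2 * Y = a ^+ 2 + b ^+ 2 - 2 * (X + B * (s + t) + Y * s * t).
  by rewrite ha hb /f; ring.
by field; rewrite bN0.
Qed.

Let cf : continuous f.
Proof.
move=> s; apply: (@cvgD _ _ _ _ _ (fun s => X + 2 * B * s)).
  by apply: cvgD; [exact: cvg_cst|apply: cvgM; [exact: cvg_cst|exact: cvg_id]].
by apply: cvgM; [exact: cvg_cst|apply: cvgM; exact: cvg_id].
Qed.

Let cl : continuous l.
Proof.
rewrite (_ : l = Num.sqrt \o f); last first.
  by apply/funext => s /=; rewrite -lf sqrtr_sqr gtr0_norm.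
by move=> s; apply: continuous_comp; [exact: cf|exact: sqrt_continuous].
Qed.

Let cu v : continuous (fun s => dotp v (u s)).
Proof.
rewrite (_ : (fun s => _) = fun s => (l s)^-1 * (dotp v m + dotp v e * s)); last first.
  by apply/funext => s; rewrite uE !dotp2E !mxE; ring.
move=> s; apply: cvgM.
  by apply: cvgV; [exact/lt0r_neq0/l0|exact: cl].
by apply: cvgD; [exact: cvg_cst|apply: cvgM; [exact: cvg_cst|exact: cvg_id]].
Qed.

(** The limit is the speed of [u] at [t]: on the diagonal, [Y f - (B + Y t)^2 = X Y - B^2 = (det2 m
    e)^2]. *)
Let cratio t : ratio p @[p --> (t, t)] --> `|det2 m e| / f t.
Proof.
have -> : `|det2 m e| / f t = Num.sqrt ((Y - ((2 * B + Y * (t + t)) / (l t + l t)) ^+ 2) /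
            (l t * l t)).
  rewrite -[f t]gtr0_norm// -normfV -normrM -sqrtr_sqr; congr Num.sqrt.
  rewrite exprMn exprVn.
  have -> : det2 m e ^+ 2 = X * Y - B ^+ 2.
    by rewrite /X /Y /B -dotp_det2; ring.
  rewrite -lf; have := l0 t; have := lf t; rewrite /f; move: (l t) => a ha a0.
  have aN0 : a != 0 by rewrite gt_eqF.
  have -> : X = a ^+ 2 - 2 * B * t - Y * t ^+ 2 by rewrite ha; ring.
  by field; rewrite aN0 -mulr2n mulrn_eq0.
apply: (@continuous_cvg _ _ _ (nbhs (t, t)) _ (fun p : R * R =>
  (Y - ((2 * B + Y * (p.1 + p.2)) / (l p.1 + l p.2)) ^+ 2) / (l p.1 * l p.2))
  (@Num.sqrt R)); first exact: sqrt_continuous.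
have c1 : l p.1 @[p --> (t, t)] --> l t.
  by apply: (@continuous_cvg _ _ _ (nbhs (t, t)) _ fst l); [exact: cl|exact: cvg_fst].
have c2 : l p.2 @[p --> (t, t)] --> l t.
  by apply: (@continuous_cvg _ _ _ (nbhs (t, t)) _ snd l); [exact: cl|exact: cvg_snd].
apply: cvgM; last first.
  by apply: cvgV; [rewrite mulf_neq0// lt0r_neq0|exact: cvgM].
apply: cvgB; first exact: cvg_cst.
have H : (2 * B + Y * (p.1 + p.2)) / (l p.1 + l p.2) @[p --> (t, t)] -->
  (2 * B + Y * (t + t)) / (l t + l t).
  apply: cvgM; last by apply: cvgV; [rewrite lt0r_neq0// addr_gt0|exact: cvgD].
  apply: cvgD; first exact: cvg_cst.
  by apply: cvgM; [exact: cvg_cst|apply: cvgD; [exact: cvg_fst|exact: cvg_snd]].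
by apply: cvgM.
Qed.

Variable q : R.
(** Since [coord1] is the inverse of [l] along the curve, [F] is there the [q]-th power of the
    radial function of the side, in a form whose measurability is plain; [density] is [F] times the
    speed of [u]. *)
Let F (v : caratheodory_type H1) : \bar R := (coord1 m e v `^ (- q))%:E.
Let density t := `|det2 m e| * f t `^ (q / 2 - 1).
Local Notation mu := (hausdorff1_measure R 2).

Let F_sphere_proj s : coord1 m e (u s) `^ (- q) = f s `^ (q / 2).
Proof.
have lE : l s = Num.sqrt (f s) by rewrite -lf sqrtr_sqr gtr0_norm.
have -> : coord1 m e (u s) = f s `^ (- 2^-1).
  by rewrite coord1_sphere_proj_edge lE powRN powR12_sqrt// ltW.
by rewrite -powRrM; congr (_ `^ _); field.
Qed.

Let F_ge0 v : (0 <= F v)%E.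
Proof. by rewrite lee_fin powR_ge0. Qed.

Let measurable_F (A : set (caratheodory_type H1)) : measurable_fun A F.
Proof.
apply/measurable_EFinP/measurable_funTS.
apply: (measurableT_comp (measurable_powR (- q))).
exact: measurable_dotp.
Qed.

(** Near [(t, t)] all chord quotients are close to the speed of [u]. The chord from [r] to [s]
    bounds the measure from below; the same estimate, read as a Lipschitz constant, bounds it from
    above. *)
Let arc_bounds t (eps : R) : 0 < eps ->
  exists2 eta, 0 < eta & forall r s, t - eta < r -> r <= s -> s < t + eta ->
    [/\ `|f r `^ (q / 2) - f t `^ (q / 2)| <= eps,
      (((`|det2 m e| / f t - eps) * (s - r))%:E <= hausdorff1 (arc m e r s))%E &
      (hausdorff1 (arc m e r s) <= ((`|det2 m e| / f t + eps) * (s - r))%:E)%E].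
Proof.
move=> eps0.
have /cvgrPdist_le /(_ eps eps0) /nbhs_ballP[eta1 /= eta10 K1] := @cratio t.
have cfq : {for t, continuous (fun s => f s `^ (q / 2))}.
  have df : is_derive t 1 f (2 * B + 2 * Y * t).
    by rewrite /f; apply: is_derive_eq; rewrite /GRing.scale/=; ring.
  have [dfq _] := is_derive_powR_comp (q / 2) (f0 t) df.
  exact/differentiable_continuous/derivable1_diffP.
have /cvgrPdist_le /(_ eps eps0) /nbhs_ballP[eta2 /= eta20 K2] := cfq.
exists (Num.min eta1 eta2); first by rewrite lt_min eta10.
move=> r s; rewrite ltrBlDr -ltrBlDl lt_min => /andP[r1 r2] rs.
rewrite -ltrBlDl lt_min => /andP[s1 s2].
have ratio_near (x y : R) : r <= x <= s -> r <= y <= s ->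
    `| `|det2 m e| / f t - ratio (x, y)| <= eps.
  move=> /andP[x1 x2] /andP[y1 y2]; apply: K1.
  by split; rewrite /ball/= ltr_norml; apply/andP; split; lra.
have chord (x y : R) : r <= x <= s -> r <= y <= s ->
    (`|det2 m e| / f t - eps) * `|x - y| <= enorm (u x - u y) <=
    (`|det2 m e| / f t + eps) * `|x - y|.
  move=> xrs yrs; rewrite enorm_chord ![_ * `|x - y|]mulrC.
  have := ratio_near _ _ xrs yrs; rewrite ler_norml => /andP[h1 h2].
  by apply/andP; split; apply: ler_wpM2l => //; lra.
split.
- rewrite distrC; apply: K2.
  by rewrite /ball/= ltr_norml; apply/andP; split; lra.
- rewrite arcE; apply: le_trans (hausdorff1_chord_ge rs _).
    rewrite lee_fin; have := @chord s r; rewrite !lexx rs => /(_ isT isT).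
    by rewrite [`|s - r|]ger0_norm ?subr_ge0// => /andP[].
  by move=> v; exact: continuous_subspaceT.
- rewrite arcE; apply: (@le_trans _ _ (hausdorff1 [set u x | x in `[r, s]])).
    apply: le_hausdorff1; apply: image_subset => x /=.
    by rewrite !in_itv/= => /andP[/ltW -> ->].
  apply: hausdorff1_lipschitz_le => //.
    by rewrite addr_ge0 ?(ltW eps0)// divr_ge0 ?(ltW (f0 _)).
  by move=> x y xrs yrs; have /andP[] := chord x y xrs yrs.
Qed.

Let arc_integral_local t (eps : R) : 0 < eps ->
  exists2 eta, 0 < eta & forall r s, t - eta < r -> r <= s -> s < t + eta ->
    (((density t - eps) * (s - r))%:E <= \int[mu]_(v in arc m e r s) F v /\
     \int[mu]_(v in arc m e r s) F v <= ((density t + eps) * (s - r))%:E)%E.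
Proof.
move=> eps0.
pose h := f t `^ (q / 2); pose k := `|det2 m e| / f t.
have h0 : 0 < h by exact: powR_gt0.
have k0 : 0 < k by rewrite divr_gt0// normr_gt0.
have densityE : density t = h * k.
  rewrite /density /h /k mulrCA; congr (_ * _).
  rewrite powRB; first by rewrite powRr1// ltW.
  by rewrite (lt0r_neq0 (f0 t)) implybT.
(* Both [(h - d) (k - d)] and [(h + d) (k + d)] differ from [h k] by at most [d (h + k + 1) <= eps];
   [d <= h] keeps the lower integrand nonnegative. *)
pose d := Num.min (Num.min h k) (Num.min 1 (eps / (h + k + 1))).
have d0 : 0 < d by rewrite !lt_min h0 k0 ltr01 divr_gt0// !addr_gt0.
have dh : d <= h by rewrite !ge_min lexx.
have dk : d <= k by rewrite !ge_min lexx orbT.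
have d1 : d <= 1 by rewrite !ge_min lexx !orbT.
have deps : d * (h + k + 1) <= eps.
  by rewrite -ler_pdivlMr ?addr_gt0// !ge_min lexx !orbT.
have [eta eta0 H] := arc_bounds t d0.
exists eta => // r s tr rs st.
have [_ lo hi] := H r s tr rs st.
have sr0 : 0 <= s - r by rewrite subr_ge0.
have Fb v : arc m e r s v -> h - d <= coord1 m e v `^ (- q) <= h + d.
  rewrite arcE => -[x /=]; rewrite in_itv/= => /andP[rx xs] <-.
  rewrite F_sphere_proj.
  have [+ _ _] := H x x (lt_trans tr rx) (lexx x) (le_lt_trans xs st).
  by rewrite ler_distl.
have marc := measurable_arc m e r s.
split.
  apply: (@le_trans _ _ (\int[mu]_(v in arc m e r s) (cst (h - d)%:E v))%E).
    rewrite integral_cst//.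
    apply: (@le_trans _ _ ((h - d)%:E * ((k - d) * (s - r))%:E)%E).
      rewrite -EFinM lee_fin mulrA ler_wpM2r// densityE; nra.
    by apply: lee_wpmul2l; rewrite ?lee_fin ?subr_ge0.
  apply: ge0_le_subset_integral => // v Av.
    by rewrite lee_fin subr_ge0.
  by rewrite lee_fin; have /andP[] := Fb _ Av.
apply: (@le_trans _ _ (\int[mu]_(v in arc m e r s) (cst (h + d)%:E v))%E).
  apply: ge0_le_subset_integral => // v Av.
    by rewrite lee_fin addr_ge0// ltW.
  by rewrite lee_fin; have /andP[] := Fb _ Av.
rewrite integral_cst//.
apply: (@le_trans _ _ ((h + d)%:E * ((k + d) * (s - r))%:E)%E).
  by apply: lee_wpmul2l => //; rewrite lee_fin addr_ge0// ltW.
rewrite -EFinM lee_fin mulrA ler_wpM2r// densityE; nra.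
Qed.

Let arc_integralD r s t : r <= s <= t ->
  (\int[mu]_(v in arc m e r t) F v =
   \int[mu]_(v in arc m e r s) F v + \int[mu]_(v in arc m e s t) F v)%E.
Proof.
move=> /andP[rs st]; rewrite -ge0_integral_setU//; last 3 first.
- exact: measurable_arc.
- exact: measurable_arc.
- rewrite disj_set2E; apply/eqP/seteqP; split=> // v [].
  by move=> [_ [_ /andP[_ h1]]] [_ [_ /andP[h2 _]]]; move: h1; rewrite leNgt h2.
congr integral; rewrite !arcE -image_setU; congr image.
apply/seteqP; split=> x; rewrite /= !in_itv/=.
  move=> /andP[rx xt]; have [xs|sx] := leP x s; [left|right]; first by rewrite rx.
  by rewrite xt.
by move=> [/andP[-> xs]|/andP[sx ->]]; rewrite ?(le_trans xs)// (le_lt_trans rs).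
Qed.

(** [cousin] glues two local comparisons, of the integral with [density t] and of the increment of
    [W] with [dW t]. The integral, the increment and the slack [d (s - r)] are all additive in the
    interval; each local estimate uses half of the slack. *)
Lemma arc_integral_le (W dW : R -> R) a b : a <= b ->
  (forall t, is_derive t 1 W (dW t)) ->
  (forall t, a <= t <= b -> density t <= dW t) ->
  (\int[mu]_(v in arc m e a b) F v <= (W b - W a)%:E)%E.
Proof.
move=> ab dWd fW; apply/lee_addgt0Pr => eps eps0.
pose d := eps / (b - a + 1).
have ba : 0 <= b - a by rewrite subr_ge0.
have d0 : 0 < d by rewrite divr_gt0// ltr_wpDl.
apply: (@le_trans _ _ (W b - W a + d * (b - a))%:E); last first.
  rewrite EFinD leeD2l// lee_fin /d -mulrA ger_pMr// mulrC ler_pdivrMr ?ltr_wpDl//.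
  by rewrite mul1r lerDl.
apply: (@cousin _ (fun r s => \int[mu]_(v in arc m e r s) F v <=
    (W s - W r + d * (s - r))%:E)%E) => // [r s t rst h1 h2|t tab].
  rewrite (arc_integralD rst); apply: le_trans (leeD h1 h2) _.
  by rewrite -EFinD lee_fin; lra.
have d20 : 0 < d / 2 by rewrite divr_gt0.
have [e1 e10 H] := arc_integral_local t d20.
have [e2 e20 K] := is_derive_straddle d20 (dWd t).
exists (Num.min e1 e2); first by rewrite lt_min e10.
move=> r s; rewrite ltrBlDr -ltrBlDl lt_min => /andP[/andP[r1 r2] rt].
rewrite -ltrBlDl lt_min => /andP[ts /andP[s1 s2]].
have rs : r <= s by exact: le_trans ts.
have [_] := H r s (ltac:(lra)) rs (ltac:(lra)).
move/le_trans; apply; rewrite lee_fin.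
have := K r s; rewrite rt ts !andbT => /(_ (ltac:(lra)) (ltac:(lra))).
rewrite ler_norml => /andP[+ _].
have := fW t tab; have : 0 <= s - r by rewrite subr_ge0.
move=> sr /(ler_wpM2r sr); lra.
Qed.

Lemma arc_integral_ge (V dV : R -> R) a b : a <= b ->
  (forall t, is_derive t 1 V (dV t)) ->
  (forall t, a <= t <= b -> dV t <= density t) ->
  ((V b - V a)%:E <= \int[mu]_(v in arc m e a b) F v)%E.
Proof.
move=> ab dVd fV; apply/lee_addgt0Pr => eps eps0.
pose d := eps / (b - a + 1).
have ba : 0 <= b - a by rewrite subr_ge0.
have d0 : 0 < d by rewrite divr_gt0// ltr_wpDl.
rewrite -leeBlDr//.
apply: (@le_trans _ _ (V b - V a - d * (b - a))%:E).
  rewrite -EFinB lee_fin lerD2l lerN2 /d -mulrA ger_pMr// mulrC.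
  by rewrite ler_pdivrMr ?ltr_wpDl// mul1r lerDl.
apply: (@cousin _ (fun r s => (V s - V r - d * (s - r))%:E <=
    \int[mu]_(v in arc m e r s) F v)%E) => // [r s t rst h1 h2|t tab].
  rewrite (arc_integralD rst); apply: le_trans (leeD h1 h2).
  by rewrite -EFinD lee_fin; lra.
have d20 : 0 < d / 2 by rewrite divr_gt0.
have [e1 e10 H] := arc_integral_local t d20.
have [e2 e20 K] := is_derive_straddle d20 (dVd t).
exists (Num.min e1 e2); first by rewrite lt_min e10.
move=> r s; rewrite ltrBlDr -ltrBlDl lt_min => /andP[/andP[r1 r2] rt].
rewrite -ltrBlDl lt_min => /andP[ts /andP[s1 s2]].
have rs : r <= s by exact: le_trans ts.
have [+ _] := H r s (ltac:(lra)) rs (ltac:(lra)).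
apply: le_trans; rewrite lee_fin.
have := K r s; rewrite rt ts !andbT => /(_ (ltac:(lra)) (ltac:(lra))).
rewrite ler_norml => /andP[_ +].
have := fV t tab; have : 0 <= s - r by rewrite subr_ge0.
move=> sr /(ler_wpM2r sr); lra.
Qed.

End fixed_basis.
End arcs.

(** * Radial and support functions of planar convex bodies *)

Section convex_bodies.
Context {R : realType}.
Implicit Types (u v w x y z m e : 'rV[R]_2).

Lemma convex_body_comb (K : set 'rV[R]_2) x y (t : R) : convex_body K ->
  K x -> K y -> 0 <= t -> t <= 1 -> K (t *: x + (1 - t) *: y).
Proof.
move=> [_ cK _] Kx Ky t0 t1.
by have /set_mem := cK x y (Itv01 t0 t1) (mem_set Kx) (mem_set Ky).
Qed.

Lemma dotp_continuous v : continuous (dotp v).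
Proof.
have c i : continuous (fun x : 'rV[R]_2 => x 0 i) by exact: coord_continuous.
rewrite (_ : dotp v = fun x => v 0 0 * x 0 0 + v 0 1 * x 0 1); last first.
  by apply/funext => x; rewrite dotp2E.
move=> x; apply: (@cvgD _ _ _ (nbhs (x : 'rV[R]_2)) _ (fun x : 'rV[R]_2 => v 0 0 * x 0 0)
   (fun x : 'rV[R]_2 => v 0 1 * x 0 1)).
  by apply: cvgM; [exact: cvg_cst|exact: c].
by apply: cvgM; [exact: cvg_cst|exact: c].
Qed.

Lemma dotp_max (A : set 'rV[R]_2) v : A !=set0 -> compact A ->
  exists2 x, A x & forall y, A y -> dotp v y <= dotp v x.
Proof.
move=> A0 cA; have [|x /set_mem Ax xmax] := EVT_max_rV (f := dotp v) A0 cA.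
  by apply: continuous_subspaceT; exact: dotp_continuous.
by exists x => // y Ay; exact/xmax/mem_set.
Qed.

Lemma compact_closed_rV2 (A : set 'rV[R]_2) : compact A -> closed A.
Proof. by apply: compact_closed; exact: norm_hausdorff. Qed.

Lemma support_fun_max (K : set 'rV[R]_2) v x : K x ->
  (forall y, K y -> dotp v y <= dotp v x) -> support_fun K v = dotp v x.
Proof.
move=> Kx xmax; apply/le_anti/andP; split.
  by apply: ge_sup; [exists (dotp v x), x|move=> _ [y Ky <-]; exact: xmax].
apply: ub_le_sup; last by exists x.
by exists (dotp v x) => _ [y Ky <-]; exact: xmax.
Qed.

(** The interior refers to the sup norm, which [enorm] dominates; halving the radius replaces the
    open ball by a closed one. *)
Lemma interior_enorm_ball (K : set 'rV[R]_2) : interior K 0 ->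
  exists2 eps, 0 < eps & forall v, enorm v <= eps -> K v.
Proof.
move=> /nbhs_ballP[d /= d0 dK]; exists (d / 2); first by rewrite divr_gt0.
move=> v vd; apply: dK; split=> // i j; rewrite /ball/= mxE sub0r normrN.
apply: le_lt_trans (_ : enorm v < d); last by rewrite (le_lt_trans vd)//; lra.
rewrite -(@ler_pXn2r _ 2)// ?nnegrE ?enorm_ge0//.
rewrite real_normK ?num_real// sqr_enorm dotp2E !ord1.
have [->|j1] := eqVneq j 0; first by rewrite -!expr2 lerDl sqr_ge0.
have -> : j = 1 by apply/val_inj; case: j j1 => [[|[|?]]].
by rewrite -!expr2 lerDr sqr_ge0.
Qed.

Lemma compact_enorm_bounded (K : set 'rV[R]_2) : compact K ->
  exists M, forall x, K x -> enorm x <= M.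
Proof.
move=> cK; have [K0|K0] := pselect (K !=set0); last first.
  by exists 0 => x Kx; exfalso; apply: K0; exists x.
have [|x /set_mem Kx xmax] := EVT_max_rV (f := fun x => dotp x x) K0 cK.
  apply: continuous_subspaceT => x.
  have c i : continuous (fun x : 'rV[R]_2 => x 0 i) by exact: coord_continuous.
  rewrite (_ : (fun x => dotp x x) = fun x => x 0 0 * x 0 0 + x 0 1 * x 0 1); last first.
    by apply/funext => y; rewrite dotp2E.
  apply: (@cvgD _ _ _ (nbhs (x : 'rV[R]_2)) _ (fun x : 'rV[R]_2 => x 0 0 * x 0 0)
   (fun x : 'rV[R]_2 => x 0 1 * x 0 1)).
    by apply: cvgM; exact: c.
  by apply: cvgM; exact: c.
by exists (enorm x) => y Ky; rewrite ler_wsqrtr// xmax// mem_set.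
Qed.

Section radial.
Variable K : set 'rV[R]_2.
Hypothesis hK : convex_body_o K.

Lemma radial_fun_ub u (r : R) : usphere u -> 0 < r -> K (r *: u) ->
  r <= radial_fun K u.
Proof.
move=> Su r0 Kr; have [M KM] := compact_enorm_bounded (let: conj (And3 _ _ c) _ := hK in c).
apply: ub_le_sup => //; exists M => s [s0 /KM].
by rewrite enormZ (ger0_norm (ltW s0)) Su mulr1.
Qed.

Lemma radial_fun_gt0 u : usphere u -> 0 < radial_fun K u.
Proof.
move=> Su; have [eps eps0 Keps] := interior_enorm_ball hK.2.
apply: (lt_le_trans eps0); apply: radial_fun_ub => //; apply: Keps.
by rewrite enormZ (ger0_norm (ltW eps0)) Su mulr1.
Qed.

Lemma radial_fun_mem u : usphere u -> K (radial_fun K u *: u).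
Proof.
move=> Su; have [[_ _ cK] iK] := hK.
have [eps eps0 Keps] := interior_enorm_ball iK.
have [M KM] := compact_enorm_bounded cK.
pose A := [set r : R | 0 < r /\ K (r *: u)].
have A0 : A !=set0.
  by exists eps; split=> //; apply: Keps; rewrite enormZ (ger0_norm (ltW eps0)) Su mulr1.
have uA : has_ubound A.
  exists M => s [s0 /KM].
  by rewrite enormZ (ger0_norm (ltW s0)) Su mulr1.
have clA : closed [set r : R | K (r *: u)].
  apply: (@closed_comp _ _ (fun r : R => r *: u)).
    by move=> r _; exact: scalel_continuous.
  exact: compact_closed_rV2.
apply: clA; apply: closureS (closure_sup A0 uA).
by move=> r [].
Qed.

Lemma radial_fun_bounded : exists M, forall u, usphere u -> radial_fun K u <= M.
Proof.
have [[_ _ cK] iK] := hK.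
have [M KM] := compact_enorm_bounded cK; exists M => u Su.
have := KM _ (radial_fun_mem Su).
by rewrite enormZ (ger0_norm (ltW (radial_fun_gt0 Su))) Su mulr1.
Qed.

Lemma row2_perp_det2 z : det2 z (row2 (- z 0 1) (z 0 0)) = dotp z z.
Proof. by rewrite dotp2E /det2 !mxE/=; ring. Qed.

(* Extending [a z |-> a] to a linear form bounded by 1 on [K] amounts to choosing
   its value [c] on an orthogonal vector; convexity bounds the constraints coming
   from the two sides of the line spanned by [z] against each other. *)
Lemma exists_support_line u : usphere u ->
  exists2 g, dotp g (radial_fun K u *: u) = 1 & forall y, K y -> dotp g y <= 1.
Proof.
move=> Su; pose z := radial_fun K u *: u.
have r0 := radial_fun_gt0 Su.
have Kz : K z by exact: radial_fun_mem.
have [cbK iK] := hK.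
have z0 : z != 0.
  rewrite -enorm_gt0 /z enormZ Su mulr1 normr_gt0; exact: lt0r_neq0.
pose w := row2 (- z 0 1) (z 0 0).
have D0 : det2 z w != 0 by rewrite row2_perp_det2 gt_eqF// dotp_gt0.
pose a := coord1 z w; pose b := coord2 z w.
(* On the line of [z] the constraint is the maximality of [radial_fun K u]. *)
have line y : K y -> b y = 0 -> a y <= 1.
  move=> Ky by0; rewrite leNgt; apply/negP => a1.
  have Ez : y = (a y * radial_fun K u) *: u.
    by rewrite {1}(coordK y D0) -/(a y) -/(b y) by0 scale0r addr0 /z scalerA.
  have a0 : 0 < a y by rewrite (lt_trans _ a1).
  have := @radial_fun_ub u (a y * radial_fun K u) Su.
  rewrite -Ez => /(_ (mulr_gt0 a0 r0) Ky).
  by rewrite leNgt -{1}[radial_fun K u]mul1r ltr_pM2r// a1.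
have linD (p : 'rV[R]_2) x y s t : dotp p (s *: x + t *: y) = s * dotp p x + t * dotp p y.
  by rewrite !dotp2E !mxE; ring.
have [eps eps0 Keps] := interior_enorm_ball iK.
pose d := eps / (enorm w + 1).
have w1 : 0 < enorm w + 1 by rewrite ltr_wpDl ?enorm_ge0.
have d0 : 0 < d by rewrite divr_gt0.
have Kdw (c : R) : `|c| = d -> K (c *: w).
  move=> cd; apply: Keps; rewrite enormZ cd /d -mulrA ger_pMr// mulrC.
  by rewrite ler_pdivrMr// mul1r lerDl.
(* The segment from [y1] to [y2] meets the line of [z] at weight [t]; [line] at that point places
   the lower constraint on [c] from [y2] below the upper one from [y1]. *)
have cross y1 y2 : K y1 -> 0 < b y1 -> K y2 -> b y2 < 0 ->
    (1 - a y2) / b y2 <= (1 - a y1) / b y1.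
  move=> K1 b1 K2 b2; pose t := - b y2 / (b y1 - b y2).
  have b12 : 0 < b y1 - b y2 by lra.
  have t0 : 0 <= t by rewrite divr_ge0// ltW//; lra.
  have t1 : t <= 1 by rewrite ler_pdivrMr// mul1r; lra.
  have K3 := convex_body_comb cbK K1 K2 t0 t1.
  have tb : t * (b y1 - b y2) = - b y2 by rewrite divfK// gt_eqF.
  have b3 : b (t *: y1 + (1 - t) *: y2) = 0.
    by rewrite /b /coord2 linD -!/(coord2 z w _) -!/(b _); lra.
  have := line _ K3 b3; rewrite /a /coord1 linD -!/(coord1 z w _) -!/(a _).
  rewrite -(ler_pM2r b12) mul1r => H.
  have {}H : - b y2 * a y1 + b y1 * a y2 <= b y1 - b y2.
    have -> : - b y2 * a y1 + b y1 * a y2 = (t * a y1 + (1 - t) * a y2) * (b y1 - b y2).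
      have -> : (t * a y1 + (1 - t) * a y2) * (b y1 - b y2) =
          t * (b y1 - b y2) * (a y1 - a y2) + (b y1 - b y2) * a y2 by ring.
      by rewrite tb; ring.
    exact: H.
  rewrite -subr_ge0 (_ : _ - _ =
    (b y1 - b y2 + a y1 * b y2 - a y2 * b y1) / (b y1 * - b y2)).
    by apply: divr_ge0; [lra|apply: mulr_ge0; lra].
  by field; rewrite (gt_eqF b1) (lt_eqF b2).
pose S := [set (1 - a y) / b y | y in [set y | K y /\ 0 < b y]].
(* These points of [K] on either side of the line of [z] provide an upper constraint and a lower
   one, so that [S] is nonempty and bounded below. *)
pose yp := d *: w; pose yn := (- d) *: w.
have byp : b yp = d by rewrite /b /yp -[d *: w]add0r -(scale0r z) coord2_comb.
have byn : b yn = - d by rewrite /b /yn -[(- d) *: w]add0r -(scale0r z) coord2_comb.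
have Kyp : K yp by apply: Kdw; rewrite ger0_norm// ltW.
have Kyn : K yn by apply: Kdw; rewrite normrN ger0_norm// ltW.
have S0 : S !=set0 by exists ((1 - a yp) / b yp), yp => //; split=> //; rewrite byp.
have lS : has_lbound S.
  exists ((1 - a yn) / b yn) => _ [y [Ky by0] <-].
  by apply: cross => //; rewrite byn oppr_lt0.
pose c := inf S.
exists (((det2 z w)^-1 *: row2 (w 0 1) (- w 0 0)) +
        c *: ((det2 z w)^-1 *: row2 (- z 0 1) (z 0 0))).
  have -> : forall p q' : 'rV[R]_2, dotp (p + c *: q') z = dotp p z + c * dotp q' z.
    by move=> p q'; rewrite !dotp2E !mxE; ring.
  rewrite -/(coord1 z w z) -/(coord2 z w z).
  have -> : coord1 z w z = 1 by rewrite coord1E divff.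
  have -> : coord2 z w z = 0 by rewrite coord2E (_ : det2 z z = 0) ?mul0r// /det2; ring.
  by rewrite mulr0 addr0.
move=> y Ky.
have -> : forall p q' : 'rV[R]_2, dotp (p + c *: q') y = dotp p y + c * dotp q' y.
  by move=> p q'; rewrite !dotp2E !mxE; ring.
rewrite -/(coord1 z w y) -/(coord2 z w y) -/(a y) -/(b y).
rewrite -lerBrDl; have [b0|b0|b0] := ltgtP (b y) 0.
- rewrite -ler_ndivrMr//; apply: lb_le_inf => // _ [y1 [K1 b1] <-].
  exact: cross.
- rewrite -ler_pdivlMr//; apply: ge_inf => //.
  by exists y.
- by rewrite b0 mulr0 subr_ge0; exact: line.
Qed.

(** The boundary point in each direction has a supporting line, whose normal is rescaled to length
    1. The denominator is thus an integral over the whole circle. *)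
Lemma reverse_radial_Gauss_image_usphere :
  reverse_radial_Gauss_image K usphere = usphere.
Proof.
apply/seteqP; split=> [u []//|u Su]; split=> //.
have [g g1 gK] := exists_support_line Su.
have g0 : g != 0.
  by apply/eqP => g0; move: g1; rewrite g0 dotp2E !mxE !mul0r addr0; apply/eqP; rewrite eq_sym oner_eq0.
have eg : 0 < enorm g by rewrite enorm_gt0.
exists (sphere_proj g); first exact: usphere_sphere_proj.
have dE y : dotp (sphere_proj g) y = (enorm g)^-1 * dotp g y.
  by rewrite /sphere_proj !dotp2E !mxE; ring.
rewrite /supporting_hyperplane /= (@support_fun_max _ _ (radial_fun K u *: u)).
- by rewrite !dotp2E; ring.
- exact: radial_fun_mem.
- move=> y Ky; rewrite !dE ler_pM2l ?invr_gt0// g1; exact: gK.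
Qed.

End radial.
End convex_bodies.

(** * Faces and inscribed parallelograms *)

Section faces.
Context {R : realType}.
Implicit Types (u v w x y z m e : 'rV[R]_2).
Variable K : set 'rV[R]_2.
Hypothesis hK : convex_body_e K.

Let hKo : convex_body_o K. Proof. exact: hK.1. Qed.
Let hKb : convex_body K. Proof. exact: hK.1.1. Qed.

Lemma convex_body_eN x : K x -> K (- x).
Proof. by move=> Kx; rewrite hK.2; exists x. Qed.

Lemma parallelogram_sub m e (a b : R) : K (m + e) -> K (m - e) ->
  `|a| <= 1 -> `|b| <= 1 -> K (a *: m + b *: e).
Proof.
move=> Kp Km /[!ler_norml]/andP[a1 a2] /andP[b1 b2].
have step (c : R) : -1 <= c <= 1 -> K (m + c *: e).
  move=> /andP[c1 c2]; have t0 : 0 <= (1 + c) / 2 by lra.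
  have t1 : (1 + c) / 2 <= 1 by lra.
  have := convex_body_comb hKb Kp Km t0 t1; congr K.
  by apply: eq_rV2; rewrite !mxE; field.
have K1 : K (m + b *: e) by apply: step; rewrite b1.
have K2 : K (- m + b *: e).
  have -> : - m + b *: e = - (m + (- b) *: e).
    by apply: eq_rV2; rewrite !mxE; ring.
  by apply/convex_body_eN/step/andP; split; lra.
have t0 : 0 <= (1 + a) / 2 by lra.
have t1 : (1 + a) / 2 <= 1 by lra.
have := convex_body_comb hKb K1 K2 t0 t1; congr K.
by apply: eq_rV2; rewrite !mxE; field.
Qed.

(** The face is a compact convex part of a line, hence the segment between the minimiser [x1] and
    the maximiser [x2] of a form [p] along that line; [m] and [e] are half their sum and half their
    difference. *)
Lemma face_segment w : enorm w = 1 -> exists m e,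
  [/\ K (m + e), K (m - e), m != 0, dotp w m = support_fun K w &
   forall x, K x -> dotp w x = support_fun K w ->
     exists2 s, -1 <= s <= 1 & x = m + s *: e].
Proof.
move=> w1; have [[K0 _ cK] iK] := hKo.
have [y Ky ymax] := dotp_max w K0 cK.
have hE := support_fun_max Ky ymax; set h := support_fun K w in hE *.
have h0 : 0 < h.
  have [eps eps0 Keps] := interior_enorm_ball iK.
  have Kw : K (eps *: w) by apply: Keps; rewrite enormZ w1 mulr1 ger0_norm// ltW.
  rewrite hE; apply: lt_le_trans (ymax _ Kw).
  have -> : dotp w (eps *: w) = eps * dotp w w by rewrite !dotp2E !mxE; ring.
  by rewrite -sqr_enorm w1 expr1n mulr1.
pose A := K `&` [set x | dotp w x = h].
have A0 : A !=set0 by exists y.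
have cA : compact A.
  apply: compact_closedI => //.
  rewrite (_ : [set x | _] = dotp w @^-1` [set h]) //.
  apply: closed_comp; last exact: closed_eq.
  by move=> x _; exact: dotp_continuous.
pose p := row2 (- w 0 1) (w 0 0).
have [x2 [K2 h2] max2] := dotp_max p A0 cA.
have [x1 [K1 h1] max1] := dotp_max (- p) A0 cA.
have dN x : dotp (- p) x = - dotp p x by rewrite !dotp2E !mxE; ring.
have min1 x : A x -> dotp p x1 <= dotp p x by move=> /max1; rewrite !dN lerN2.
have ww : w 0 0 * w 0 0 + w 0 1 * w 0 1 = 1.
  by rewrite -dotp2E -sqr_enorm w1 expr1n.
have eqw x z : dotp w x = dotp w z -> dotp p x = dotp p z -> x = z.
  rewrite !dotp2E !mxE/= => E1 E2; apply: eq_rV2.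
    transitivity (w 0 0 * (w 0 0 * x 0 0 + w 0 1 * x 0 1) - w 0 1 * (- w 0 1 * x 0 0 + w 0 0 * x 0 1)).
      by rewrite -[LHS]mul1r -ww; ring.
    by rewrite E1 E2 -[RHS]mul1r -ww; ring.
  transitivity (w 0 1 * (w 0 0 * x 0 0 + w 0 1 * x 0 1) + w 0 0 * (- w 0 1 * x 0 0 + w 0 0 * x 0 1)).
    by rewrite -[LHS]mul1r -ww; ring.
  by rewrite E1 E2 -[RHS]mul1r -ww; ring.
pose m := 2^-1 *: (x1 + x2); pose e := 2^-1 *: (x2 - x1).
have wm : dotp w m = h.
  have -> : dotp w m = (dotp w x1 + dotp w x2) / 2 by rewrite !dotp2E !mxE; field.
  by rewrite h1 h2; field.
have me : m + e = x2 by apply: eq_rV2; rewrite !mxE; field.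
have mNe : m - e = x1 by apply: eq_rV2; rewrite !mxE; field.
exists m, e; split; rewrite ?me ?mNe//.
  by apply/eqP => m0; move: wm h0; rewrite m0 => <-; rewrite dotp2E !mxE !mulr0 addr0 ltxx.
move=> x Kx xh; have Ax : A x by [].
have t1 := min1 x Ax; have t2 := max2 x Ax.
have pe s : dotp p (m + s *: e) = (dotp p x1 + dotp p x2) / 2 + s * ((dotp p x2 - dotp p x1) / 2).
  by rewrite !dotp2E !mxE; field.
have wes s : dotp w (m + s *: e) = h.
  have -> : dotp w (m + s *: e) = dotp w m + s * ((dotp w x2 - dotp w x1) / 2).
    by rewrite !dotp2E !mxE; field.
  by rewrite wm h1 h2 subrr mul0r mulr0 addr0.
(* In the first case the face is a point and [e = 0]; the formula for the parameter would divide by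
   zero. *)
have [E|E] := eqVneq (dotp p x1) (dotp p x2).
  exists 0; first by rewrite lerN10 ler01.
  apply: eqw; rewrite ?wes// pe E.
  by apply/eqP; rewrite eq_le; apply/andP; split; lra.
have d0 : 0 < dotp p x2 - dotp p x1.
  by rewrite subr_gt0 lt_neqAle E (le_trans t1).
exists ((2 * dotp p x - dotp p x1 - dotp p x2) / (dotp p x2 - dotp p x1)).
  rewrite ler_pdivlMr// ler_pdivrMr//; apply/andP; split; lra.
apply: eqw; first by rewrite wes.
by rewrite pe; field; exact: lt0r_neq0.
Qed.

Lemma support_funN w : support_fun K (- w) = support_fun K w.
Proof.
have [[K0 _ cK] iK] := hKo.
have [y Ky ymax] := dotp_max w K0 cK.
rewrite (support_fun_max Ky ymax) (@support_fun_max _ _ _ (- y)).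
- by rewrite !dotp2E !mxE; ring.
- exact: convex_body_eN.
- move=> z /convex_body_eN /ymax; rewrite !dotp2E !mxE; lra.
Qed.

(** [L] meets the circle in [w] and [- w], and by symmetry the face with normal [- w] is the
    reflection of the one with normal [w], so one pair [m], [e] describes both. *)
Lemma reverse_radial_Gauss_image_line L : line_through_origin L ->
  exists m e, [/\ K (m + e), K (m - e), m != 0 &
   forall u, reverse_radial_Gauss_image K (usphere `&` L) u ->
     exists2 s, -1 <= s <= 1 & radial_fun K u *: u = m + s *: e \/
                               radial_fun K u *: u = - m - s *: e].
Proof.
move=> [v v0 ->].
have w1 : enorm (sphere_proj v) = 1 by exact: usphere_sphere_proj.
have [m [e [Kp Km m0 wm face]]] := face_segment w1.
exists m, e; split=> // u [Su [x [Sx [t _ xE]] Hx]].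
set w := sphere_proj v in w1 wm face.
have Ku := radial_fun_mem hKo Su; set z := radial_fun K u *: u in Ku Hx *.
have vE : v = enorm v *: w.
  by rewrite /w /sphere_proj scalerA mulfV ?scale1r// gt_eqF// enorm_gt0.
have xw : x = (t * enorm v) *: w by rewrite -scalerA -vE xE.
have tv : `|t * enorm v| = 1.
  by have : enorm x = 1 by []; rewrite xw enormZ w1 mulr1.
have : x = w \/ x = - w.
  move/eqP: tv; rewrite eqr_norml ler01 andbT xw => /orP[]/eqP ->.
    by left; rewrite scale1r.
  by right; rewrite scaleN1r.
move: Hx; rewrite /supporting_hyperplane /= => + [] {}xw; rewrite xw.
  move=> Hx; have [|s s1 zE] := face z Ku.
    by rewrite -Hx !dotp2E; ring.
  by exists s => //; left.
rewrite support_funN => Hx.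
have [|s s1 zE] := face (- z) (convex_body_eN Ku).
  by rewrite -Hx !dotp2E !mxE; ring.
by exists s => //; right; rewrite -[z]opprK zE opprD.
Qed.

End faces.

(** * Sectors of the parallelogram and their integrals *)

Section gauge.
Context {R : realType}.
Implicit Types (u v w x y z m e : 'rV[R]_2).
Local Notation H1 := (@hausdorff1 R 2).
Local Notation mu := (hausdorff1_measure R 2).

(* The gauge of the parallelogram with vertices [m + e], [m - e], [- m + e] and
   [- m - e]. *)
Definition pgauge m e v : R := Num.max `|coord1 m e v| `|coord2 m e v|.

(** The substitution [(m, e) -> (e, - m)] passes from one side of the parallelogram to the next, so
    that results about one sector transfer to the other three. *)
Lemma det2_rot m e : det2 e (- m) = det2 m e.
Proof. by rewrite /det2 !mxE; ring. Qed.

Lemma coord1_rot m e v : coord1 e (- m) v = coord2 m e v.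
Proof. by rewrite coord1E coord2E det2_rot /det2 !mxE; congr (_ / _); ring. Qed.

Lemma coord2_rot m e v : coord2 e (- m) v = - coord1 m e v.
Proof. by rewrite coord1E coord2E det2_rot -mulNr /det2; congr (_ / _); ring. Qed.

Lemma pgauge_rot m e v : pgauge e (- m) v = pgauge m e v.
Proof. by rewrite /pgauge coord1_rot coord2_rot normrN maxC. Qed.

Lemma pgaugeN m e v : pgauge (- m) (- e) v = pgauge m e v.
Proof. by rewrite 2!pgauge_rot. Qed.

Lemma pgauge_gt0 m e v : det2 m e != 0 -> v != 0 -> 0 < pgauge m e v.
Proof.
move=> D0 v0; rewrite lt_max !normr_gt0 -negb_and; apply: contra v0.
by move=> /andP[/eqP a0 /eqP b0]; rewrite (coordK v D0) a0 b0 !scale0r addr0.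
Qed.

Lemma measurable_pgauge_powR m e (q : R) (A : set (caratheodory_type H1)) :
  measurable_fun A (fun v => (pgauge m e v `^ (- q))%:E).
Proof.
apply/measurable_EFinP/measurable_funTS.
apply: (measurableT_comp (measurable_powR (- q))).
by apply: measurable_maxr; apply: measurableT_comp => //; exact: measurable_dotp.
Qed.

(** The directions of the side from [m - e], excluded, to [m + e], included. *)
Definition quarter m e := arc m e (-1) 1.

Lemma pgauge_quarter m e v : quarter m e v -> pgauge m e v = coord1 m e v.
Proof.
move=> [_ [a0 /andP[ab ba]]]; rewrite /pgauge (ger0_norm (ltW a0)).
by apply/max_idPl; rewrite ler_norml; apply/andP; split; lra.
Qed.

(** The strict inequality is stated between real bounds because the integrals are extended reals. *)
Lemma quarter_integral_bounds m e (q : R) : det2 m e != 0 -> 2 < q ->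
  exists M M' : R, [/\ 0 <= M, M < (q - 1) * M',
   (\int[mu]_(v in quarter m e) (pgauge m e v `^ (- q))%:E <= M%:E)%E &
   (M'%:E <= \int[mu]_(v in quarter e (- m)) (pgauge m e v `^ (- q))%:E)%E].
Proof.
move=> D0 q2; pose k := q / 2 - 1.
have k0 : 0 < k by rewrite /k; lra.
have X0 := det2_dotp_gt0 D0; have BXY := det2_cauchy_schwarz D0.
have D0' : det2 e (- m) != 0 by rewrite det2_rot.
have D1 : 0 < `|det2 m e| by rewrite normr_gt0.
have [W [dW [dWd Wf WM]]] := quadratic_powR_majorant X0 BXY k0.
(* The adjacent side is [s |-> e - s m], so [B] changes sign. Its end values are those of the first
   side in reverse order, which makes the two boundary expressions equal. *)
have BXY' : (- dotp m e) ^+ 2 < dotp m m * dotp e e by rewrite sqrrN.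
have [V [dV [dVd Vf VM]]] := quadratic_powR_minorant X0 BXY' k0.
have scaled (F dF : R -> R) : (forall s : R, is_derive s 1 F (dF s)) ->
    forall s : R, is_derive s 1 (fun s => `|det2 m e| * F s) (`|det2 m e| * dF s).
  by move=> Fd s; have := Fd s => H; apply: is_derive_eq; rewrite /GRing.scale/=; ring.
have Jle : (\int[mu]_(v in quarter m e) (pgauge m e v `^ (- q))%:E <=
    (`|det2 m e| * W 1 - `|det2 m e| * W (-1))%:E)%E.
  rewrite (eq_integral (fun v : caratheodory_type H1 => (coord1 m e v `^ (- q))%:E)); last first.
    by move=> v /set_mem /pgauge_quarter ->.
  apply: (arc_integral_le D0 (ltac:(lra) : -1 <= 1 :> R) (scaled _ _ dWd)) => s s1.
  by rewrite ler_pM2l//; exact: Wf.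
have Jge : ((`|det2 m e| * V 1 - `|det2 m e| * V (-1))%:E <=
    \int[mu]_(v in quarter e (- m)) (pgauge m e v `^ (- q))%:E)%E.
  rewrite (eq_integral (fun v : caratheodory_type H1 => (coord1 e (- m) v `^ (- q))%:E)); last first.
    by move=> v /set_mem Qv; rewrite -pgauge_rot (pgauge_quarter Qv).
  apply: (arc_integral_ge D0' (ltac:(lra) : -1 <= 1 :> R) (scaled _ _ dVd)) => s s1.
  rewrite det2_rot ler_pM2l//; apply: le_trans (Vf s s1) _.
  rewrite le_eqVlt; apply/orP; left; apply/eqP; congr (_ `^ _).
  by rewrite !dotp2E !mxE; ring.
exists (`|det2 m e| * W 1 - `|det2 m e| * W (-1)),
       (`|det2 m e| * V 1 - `|det2 m e| * V (-1)); split=> //.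
  rewrite -lee_fin; apply: le_trans Jle.
  by apply: integral_ge0 => v _; rewrite lee_fin powR_ge0.
rewrite -!mulrBr mulrCA ltr_pM2l//; apply: le_lt_trans WM _.
have -> : q - 1 = 2 * k + 1 by rewrite /k; field.
apply: le_lt_trans VM; rewrite le_eqVlt; apply/orP; left; apply/eqP.
have -> : dotp m m + 2 * dotp m e * 1 + dotp e e * 1 ^+ 2 =
   dotp m m * (-1) ^+ 2 + 2 * - dotp m e * -1 + dotp e e by ring.
have -> : dotp m m + 2 * dotp m e * -1 + dotp e e * (-1) ^+ 2 =
   dotp m m * 1 ^+ 2 + 2 * - dotp m e * 1 + dotp e e by ring.
by rewrite !mulNr opprK [RHS]addrC.
Qed.

(** The set consists of [w / |w|] and its opposite. It accounts for the corners missed by half-open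
    sectors and for faces reduced to a point. *)
Lemma usphere_det2_null w : w != 0 ->
  H1.-cara.-measurable (usphere `&` [set v | det2 w v = 0]) /\
  H1 (usphere `&` [set v | det2 w v = 0]) = 0%E.
Proof.
move=> w0; split.
  rewrite (_ : [set v | _] = [set v | dotp (row2 (- w 0 1) (w 0 0)) v <= 0] `&`
     [set v | dotp (- row2 (- w 0 1) (w 0 0)) v <= 0]).
    by apply: measurableI; [exact: measurable_usphere|
      apply: measurableI; exact: measurable_halfplane].
  apply/seteqP; split=> v /=; rewrite /det2 !dotp2E !mxE/=; first by split; lra.
  by move=> [h1 h2]; apply/le_anti/andP; split; lra.
apply/eqP; rewrite eq_le hausdorff1_ge0 andbT.
apply: (@le_trans _ _ (H1 ([set sphere_proj w] `|` [set - sphere_proj w]))).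
  apply: le_hausdorff1 => v [Sv /= wv].
  have ww : 0 < dotp w w by rewrite dotp_gt0.
  have ew : 0 < enorm w by rewrite enorm_gt0.
  pose c := dotp w v / dotp w w.
  have vE : v = (c * enorm w) *: sphere_proj w.
    rewrite /sphere_proj scalerA mulfK ?gt_eqF//.
    have cw : c * dotp w w = dotp w v by rewrite divfK// gt_eqF.
    have wN0 : dotp w w != 0 by rewrite gt_eqF.
    apply: (scalerI wN0); rewrite scalerA mulrC cw.
    move: wv; rewrite /det2 => wv.
    apply: eq_rV2; rewrite !mxE !dotp2E.
      transitivity ((w 0 0 * v 0 0 + w 0 1 * v 0 1) * w 0 0 - w 0 1 * (w 0 0 * v 0 1 - w 0 1 * v 0 0)); first by ring.
      by rewrite wv mulr0 subr0.
    transitivity ((w 0 0 * v 0 0 + w 0 1 * v 0 1) * w 0 1 + w 0 0 * (w 0 0 * v 0 1 - w 0 1 * v 0 0)); first by ring.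
    by rewrite wv mulr0 addr0.
  have : `|c * enorm w| = 1.
    have Sv' : enorm v = 1 by [].
    by move: Sv'; rewrite {1}vE enormZ (usphere_sphere_proj w0) mulr1.
  move/eqP; rewrite eqr_norml ler01 andbT => /orP[]/eqP cE; rewrite vE cE.
    by left; rewrite /= scale1r.
  by right; rewrite /= scaleN1r.
apply: le_trans (outer_measureU2 H1 _ _) _.
by rewrite /= !hausdorff1_set1 adde0.
Qed.

End gauge.

Section parallelogram_bounds.
Context {R : realType}.
Implicit Types (u v w x y z m e : 'rV[R]_2).
Local Notation H1 := (@hausdorff1 R 2).
Local Notation mu := (hausdorff1_measure R 2).
Variables (K : set 'rV[R]_2) (m e : 'rV[R]_2) (q : R).
Hypotheses (hK : convex_body_e K) (Kp : K (m + e)) (Km : K (m - e)).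
Hypotheses (D0 : det2 m e != 0) (q2 : 2 < q).

Let G (v : caratheodory_type H1) : \bar R := (pgauge m e v `^ (- q))%:E.
Let rho (v : caratheodory_type H1) : \bar R := (radial_fun K v `^ q)%:E.
Let Q13 := quarter m e `|` quarter (- m) (- e).
Let Q24 := quarter e (- m) `|` quarter (- e) m.

Let G0 v : (0 <= G v)%E. Proof. by rewrite lee_fin powR_ge0. Qed.
Let rho0 v : (0 <= rho v)%E. Proof. by rewrite lee_fin powR_ge0. Qed.

Let mQ m' e' : H1.-cara.-measurable (quarter m' e').
Proof. exact: measurable_arc. Qed.

Let usphere_neq0 u : usphere u -> u != 0.
Proof. by move=> Su; rewrite -enorm_gt0; have -> : enorm u = 1 by []. Qed.

Let quarterE v (a := coord1 m e v) (b := coord2 m e v) :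
  [/\ quarter m e v -> 0 < a /\ - a < b <= a,
      quarter e (- m) v -> 0 < b /\ - b <= a < b,
      quarter (- m) (- e) v -> a < 0 /\ a <= b < - a &
      quarter (- e) m v -> b < 0 /\ b < a <= - b].
Proof.
have c1 : coord1 (- m) (- e) v = - a by rewrite coord1_rot coord2_rot.
have c2 : coord2 (- m) (- e) v = - b by rewrite coord2_rot coord1_rot.
have c3 : coord1 (- e) m v = - b by rewrite -[m]opprK coord1_rot c2.
have c4 : coord2 (- e) m v = a by rewrite -[m]opprK coord2_rot c1 opprK.
split=> -[_ []]; rewrite ?c1 ?c2 ?c3 ?c4 ?coord1_rot ?coord2_rot -/a -/b;
  move=> a0 /andP[h1 h2]; split; rewrite ?oppr_gt0 //; try lra; apply/andP; split; lra.
Qed.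

Lemma quarter_integralU :
  (\int[mu]_(v in Q13) G v =
   \int[mu]_(v in quarter m e) G v + \int[mu]_(v in quarter (- m) (- e)) G v)%E /\
  (\int[mu]_(v in Q24) G v =
   \int[mu]_(v in quarter e (- m)) G v + \int[mu]_(v in quarter (- e) m) G v)%E.
Proof.
split; apply: ge0_integral_setU => //; try exact: measurable_pgauge_powR.
  rewrite disj_set2E; apply/eqP/seteqP; split=> // v [h1 h2].
  have [/(_ h1)[+ _] _ /(_ h2)[+ _] _] := quarterE v.
  by move=> a0 /(lt_trans a0); rewrite ltxx.
rewrite disj_set2E; apply/eqP/seteqP; split=> // v [h1 h2].
have [_ /(_ h1)[+ _] _ /(_ h2)[+ _]] := quarterE v.
by move=> a0 /(lt_trans a0); rewrite ltxx.
Qed.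

(** [v / pgauge m e v] lies in the parallelogram, hence in [K], so [radial_fun K v] is at least the
    inverse gauge; the sectors are disjoint parts of the circle. *)
Lemma quarter_integral_sum_le :
  (\int[mu]_(v in Q13) G v + \int[mu]_(v in Q24) G v <=
   \int[mu]_(v in reverse_radial_Gauss_image K usphere) rho v)%E.
Proof.
rewrite reverse_radial_Gauss_image_usphere; last exact: hK.1.
rewrite -ge0_integral_setU //; last 4 first.
- exact: measurableU.
- exact: measurableU.
- exact: measurable_pgauge_powR.
- rewrite disj_set2E; apply/eqP/seteqP; split=> // v [h1 h2].
  have [k1 k2 k3 k4] := quarterE v.
  by case: h1 => [/k1|/k3] [a0 /andP[h3 h4]]; case: h2 => [/k2|/k4] [b0 /andP[h5 h6]]; lra.
apply: ge0_le_subset_integral => //.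
  by move=> v [[]|[]] [].
move=> v Qv; have Sv : usphere v by case: Qv => [[]|[]] [].
have g0 := pgauge_gt0 D0 (usphere_neq0 Sv).
rewrite lee_fin (_ : - q = -1 * q); last by rewrite mulN1r.
rewrite powRrM powR_inv1 ?(ltW g0)//.
have gV0 : 0 < (pgauge m e v)^-1 by rewrite invr_gt0.
apply: ge0_ler_powR.
- by rewrite (le_trans _ (ltW q2)).
- by rewrite nnegrE ltW.
- by rewrite nnegrE ltW// radial_fun_gt0//; exact: hK.1.
apply: radial_fun_ub => //; first exact: hK.1.
have -> : (pgauge m e v)^-1 *: v = ((pgauge m e v)^-1 * coord1 m e v) *: m +
   ((pgauge m e v)^-1 * coord2 m e v) *: e.
  by rewrite {2}(coordK v D0) scalerDr !scalerA.
apply: (parallelogram_sub hK Kp Km);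
  by rewrite normrM (ger0_norm (ltW gV0)) mulrC ler_pdivrMr// mul1r le_max lexx ?orbT.
Qed.

Lemma quarter_integral_bounds2 : exists M M' : R,
  [/\ 0 <= M, M < (q - 1) * M', (\int[mu]_(v in Q13) G v <= M%:E)%E &
   (M'%:E <= \int[mu]_(v in Q24) G v)%E].
Proof.
have [M1 [M1' [M10 M11 h1 h2]]] := quarter_integral_bounds D0 q2.
have D0' : det2 (- m) (- e) != 0 by rewrite !det2_rot.
have [M2 [M2' [M20 M21 h3 h4]]] := quarter_integral_bounds D0' q2.
exists (M1 + M2), (M1' + M2'); have [-> ->] := quarter_integralU.
have gE : (fun v => (pgauge (- m) (- e) v `^ (- q))%:E) = G.
  by apply/funext => v; rewrite pgaugeN.
rewrite gE in h3 h4; rewrite opprK in h4.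
split; [exact: addr_ge0|by rewrite mulrDr ltrD| |].
  by rewrite EFinD leeD.
by rewrite EFinD leeD.
Qed.

(** Over the two faces, [radial_fun K] is the inverse gauge. The half-open sectors miss the
    directions of [m - e] and its opposite, so the null set [P] is adjoined. *)
Lemma face_integral_le (E : set 'rV[R]_2) :
  (forall u, E u -> usphere u /\ exists2 s, -1 <= s <= 1 &
     radial_fun K u *: u = m + s *: e \/ radial_fun K u *: u = - m - s *: e) ->
  (\int[mu]_(v in E) rho v <= \int[mu]_(v in Q13) G v)%E.
Proof.
move=> Eface.
have me0 : m - e != 0.
  apply: contra D0; rewrite subr_eq0 => /eqP ->.
  by rewrite /det2 mulrC subrr.
have [mP P0] := usphere_det2_null me0; set P := usphere `&` _ in mP P0.
have mQ13 : H1.-cara.-measurable Q13 by exact: measurableU.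
have mPD : H1.-cara.-measurable (P `\` Q13) by exact: measurableD.
have -> : (\int[mu]_(v in Q13) G v = \int[mu]_(v in Q13 `|` (P `\` Q13)) G v)%E.
  rewrite [RHS]ge0_integral_setU//; last 2 first.
  - exact: measurable_pgauge_powR.
  - by rewrite disj_set2E setDIK.
  rewrite [X in (_ + X)%E](_ : _ = 0%E) ?adde0//.
  apply: null_set_integral => //; first exact: measurable_pgauge_powR.
  apply/eqP; rewrite eq_le hausdorff1_ge0 andbT -P0.
  by apply: le_hausdorff1; exact: subDsetl.
rewrite setDE setUIr setUCr setIT.
have key u : E u -> (Q13 `|` P) u /\ radial_fun K u = (pgauge m e u)^-1.
  move=> /Eface[Su [s /andP[s1 s2] uE]].
  have r0 := radial_fun_gt0 hK.1 Su.
  set r := radial_fun K u in r0 uE *.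
  have rV0 : 0 < r^-1 by rewrite invr_gt0.
  have uV : u = r^-1 *: (r *: u) by rewrite scalerA mulVf ?scale1r// gt_eqF.
  have : (coord1 m e u = r^-1 /\ coord2 m e u = r^-1 * s) \/
         (coord1 m e u = - r^-1 /\ coord2 m e u = - (r^-1 * s)).
    case: uE => uE; [left|right]; rewrite uV uE.
      by rewrite scalerDr scalerA coord1_comb// coord2_comb.
    rewrite scalerBr scalerN scalerA -!scaleNr.
    by rewrite coord1_comb// coord2_comb.
  move=> cE; split.
    have [sN1|sN1] := eqVneq s (-1).
      right; split=> //=; rewrite /det2 !mxE.
      have -> : (m 0 0 - e 0 0) * u 0 1 - (m 0 1 - e 0 1) * u 0 0 =
        det2 m e * (coord1 m e u + coord2 m e u).
        by rewrite coord1E coord2E /det2; move: D0; rewrite /det2 => D0'; field.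
      by case: cE => -[-> ->]; rewrite sN1; ring.
    have {}s1 : -1 < s by rewrite lt_neqAle eq_sym sN1.
    left; case: cE => -[c1 c2]; [left|right]; split=> //.
      rewrite c1 c2; split=> //; rewrite mulN1r mul1r; apply/andP; split.
        by rewrite -mulrN1 ltr_pM2l.
      by rewrite ger_pMr.
    rewrite coord1_rot coord2_rot coord2_rot coord1_rot c1 c2 !opprK; split=> //.
    rewrite mulN1r mul1r; apply/andP; split; first by rewrite -mulrN1 ltr_pM2l.
    by rewrite ger_pMr.
  have -> : pgauge m e u = r^-1; last by rewrite invrK.
  have sn : `|r^-1 * s| <= `|r^-1|.
    by rewrite normrM ler_piMr// ler_norml s1 s2.
  rewrite /pgauge; case: cE => -[-> ->]; rewrite ?normrN.
    by rewrite (max_idPl sn) ger0_norm// ltW.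
  by rewrite (max_idPl sn) ger0_norm// ltW.
apply: ge0_le_subset_integral => // u Eu; first by have [] := key u Eu.
have [_ rE] := key u Eu; have [Su _] := Eface u Eu.
have g0 := pgauge_gt0 D0 (usphere_neq0 Su).
rewrite lee_fin rE (_ : - q = -1 * q); last by rewrite mulN1r.
by rewrite powRrM powR_inv1 ?(ltW g0).
Qed.

End parallelogram_bounds.

(** * The ratio of the two measures *)

Section ratio.
Context {R : realType}.

(** For finite [d], [q n <= q i = i + (q - 1) i < (q - 1) (M' + i) <= (q - 1) d], because
    [i <= M < (q - 1) M'] and [i + M' <= i + o <= d]. *)
Lemma half_ratio_lt (n i o d : \bar R) (q M M' : R) : 2 < q ->
  0 <= M -> M < (q - 1) * M' ->
  (0 <= n)%E -> (n <= i)%E -> (i <= M%:E)%E -> (M'%:E <= o)%E -> (i + o <= d)%E ->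
  ((2^-1)%:E * n / ((2^-1)%:E * d) < ((q - 1) / q)%:E)%E.
Proof.
move=> q2 M0 MM' n0 ni iM M'o iod.
have q0 : 0 < q by lra.
have M'0 : 0 < M'.
  have : 0 < (q - 1) * M' by exact: le_lt_trans MM'.
  by rewrite pmulr_rgt0//; lra.
have i0 := le_trans n0 ni.
have ifin : i \is a fin_num by rewrite ge0_fin_numE// (le_lt_trans iM)// ltry.
have nfin : n \is a fin_num.
  by rewrite ge0_fin_numE// (le_lt_trans ni)// ltey_eq ifin.
move: ni iM iod i0; rewrite -(fineK ifin); set i' := fine i => ni iM iod i0.
move: ni n0; rewrite -(fineK nfin); set n' := fine n => ni n0.
rewrite !lee_fin in ni n0 iM i0.
have : ((i' + M')%:E <= d)%E.
  by apply: le_trans iod; rewrite EFinD leeD2l.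
have c0 : 0 < (q - 1) / q by rewrite divr_gt0//; lra.
(* For [d = +oo] the quotient is 0. *)
case: d {iod} => [d|_|//]; last first.
  by rewrite gt0_muley ?lte_fin ?invr_gt0// mulr0.
rewrite lee_fin => id.
have d0 : 0 < d by apply: lt_le_trans id; rewrite ltr_wpDl.
rewrite -!EFinM inver gt_eqF ?mulr_gt0 ?invr_gt0// -EFinM lte_fin.
rewrite invfM invrK [_^-1 * n']mulrC -mulrA mulKf// ?lt0r_neq0//.
rewrite ltr_pdivrMr// mulrAC ltr_pdivlMr//.
have : (q - 1) * (i' + M') <= (q - 1) * d by rewrite ler_wpM2l//; lra.
have : n' * q <= i' * q by rewrite ler_wpM2r// ltW.
by nra.
Qed.

End ratio.

Unset Implicit Arguments.
Theorem theorem1p11 (R : realType) (K : set 'rV[R]_2) (q : R)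
    (L : set 'rV[R]_2) (hK : convex_body_e K) (hq : 2 < q)
    (hL : line_through_origin L) :
  (dual_curvature q K (usphere `&` L) / dual_curvature q K usphere
     < ((q - 1) / q)%:E)%E.
Proof.
have [m [e [Kp Km m0 face]]] := reverse_radial_Gauss_image_line hK hL.
have ge0_int A : (0 <= \int[hausdorff1_measure R 2]_(u in A) (radial_fun K u `^ q)%:E)%E.
  by apply: integral_ge0 => u _; rewrite lee_fin powR_ge0.
have [D0|D0] := eqVneq (det2 m e) 0; last first.
  have [M [M' [h1 h2 h3 h4]]] := quarter_integral_bounds2 D0 hq.
  apply: (half_ratio_lt hq h1 h2 _ _ h3 h4 (quarter_integral_sum_le hK Kp Km D0 hq)) => //.
  by apply: face_integral_le => // u Eu; split; [case: Eu|exact: face].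
(* Here [e] is a multiple of [m]. A square inside [K], unrelated to the face, supplies the bounds on
   the denominator; the numerator will be shown to vanish. *)
have [eps eps0 Keps] := interior_enorm_ball hK.1.2.
pose m' := row2 (eps / 2) 0; pose e' := row2 0 (eps / 2).
(* The corners of the square have norm [eps / sqrt 2]. *)
have en2 (s : R) : s ^+ 2 = 1 -> enorm (m' + s *: e') <= eps.
  move=> s1; rewrite -(@ler_pXn2r _ 2)// ?nnegrE ?enorm_ge0 ?(ltW eps0)//.
  rewrite sqr_enorm dotp2E !mxE/=.
  have := sqr_ge0 eps; have : (eps / 2 * s) ^+ 2 = eps ^+ 2 / 4 by rewrite exprMn s1; field.
  by nra.
have Kp' : K (m' + e') by rewrite -[e']scale1r; apply/Keps/en2; rewrite expr1n.
have Km' : K (m' - e') by rewrite -scaleN1r; apply/Keps/en2; rewrite sqrrN expr1n.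
have D0' : det2 m' e' != 0.
  by rewrite /det2 !mxE/= mul0r subr0 mulf_neq0// mulf_neq0 ?gt_eqF// invr_eq0.
have [M [M' [h1 h2 h3 h4]]] := quarter_integral_bounds2 D0' hq.
apply: (half_ratio_lt hq h1 h2 _ _ h3 h4 (quarter_integral_sum_le hK Kp' Km' D0' hq)) => //.
apply: (@le_trans _ _ 0%E); last first.
  by apply: integral_ge0 => u _; rewrite lee_fin powR_ge0.
have [mP P0] := usphere_det2_null m0.
have [C rC] := radial_fun_bounded hK.1.
(* The image lies on the line of [m], which meets the circle in a null set; bounding the integrand
   there by a constant leaves an integral that is 0. *)
suff : (\int[hausdorff1_measure R 2]_(u in reverse_radial_Gauss_image K
      (usphere `&` L)) (radial_fun K u `^ q)%:E <=
    \int[hausdorff1_measure R 2]_(u in usphere `&` [set v | det2 m v = 0%R])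
      (cst (C `^ q)%:E u))%E.
  by move/le_trans; apply; rewrite integral_cst//= [X in (_ * X)%E]P0 mule0.
apply: ge0_le_subset_integral => [u Eu|u _|u _|u Eu].
- have [Su _] := Eu; split=> //=.
  have r0 := radial_fun_gt0 hK.1 Su.
  have [s _ uE] := face u Eu.
  have : det2 m (radial_fun K u *: u) = 0.
    case: uE => ->; move: D0; rewrite /det2 !mxE => D0.
      rewrite (_ : _ - _ = s * (m 0 0 * e 0 1 - m 0 1 * e 0 0)); last by ring.
      by rewrite D0 mulr0.
    rewrite (_ : _ - _ = - s * (m 0 0 * e 0 1 - m 0 1 * e 0 0)); last by ring.
    by rewrite D0 mulr0.
  have -> : det2 m (radial_fun K u *: u) = radial_fun K u * det2 m u.
    by rewrite /det2 !mxE; ring.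
  by move/eqP; rewrite mulf_eq0 gt_eqF//= => /eqP.
- by rewrite lee_fin powR_ge0.
- by rewrite lee_fin powR_ge0.
- have [Su _] := Eu; have r0 := radial_fun_gt0 hK.1 Su; have rCu := rC u Su.
  rewrite lee_fin; apply: ge0_ler_powR; rewrite ?nnegrE//; first lra.
    exact: ltW.
  exact: le_trans (ltW r0) _.
Qed.
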